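(* (i) Let $\mathcal{E}_1$ and $\mathcal{E}_2$ be two ellipsoids of revolution in $\mathbb{R}^n$ such that $V_n(\mathcal{E}_1)=V_n(\mathcal{E}_2)$, $V_k(\mathcal{E}_1)=V_k(\mathcal{E}_2)$ and $V_{n-k}(\mathcal{E}_1)=V_{n-k}(\mathcal{E}_2)$ for some integer $k$ with $1\le k\le n-1$ and $k\neq n/2$. Then $\mathcal{E}_1$ and $\mathcal{E}_2$ are congruent. (ii) Let $n$ be even and let $k$ be an integer with $1\le k\le n-1$ and $k\ne n/2$. Then $V_n$, $V_{n/2}$ and $V_k$ uniquely determine an ellipsoid of revolution up to an isometry; that is, if $\mathcal{E}_1$ and $\mathcal{E}_2$ are ellipsoids of revolution in $\mathbb{R}^n$ with $V_n(\mathcal{E}_1)=V_n(\mathcal{E}_2)$, $V_{n/2}(\mathcal{E}_1)=V_{n/2}(\mathcal{E}_2)$ and $V_k(\mathcal{E}_1)=V_k(\mathcal{E}_2)$, then $\mathcal{E}_1$ and $\mathcal{E}_2$ are congruent.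
   Context: An ellipsoid of revolution in $\mathbb{R}^n$ is the image under an isometry of $\mathbb{R}^n$ of a set of the form $$\left\{x\in\mathbb{R}^n:\frac{x_1^2}{a^2}+\cdots+\frac{x_{n-1}^2}{a^2}+\frac{x_n^2}{b^2}\le 1\right\},\qquad a,b>0.$$ For a convex body $K\subset\mathbb{R}^n$ (a compact convex set with non-empty interior), the intrinsic volumes $V_0(K),\ldots,V_n(K)$ are the coefficients defined by the Steiner formula: for every $\epsilon>0$, $$\mathrm{vol}(K+\epsilon B_2^n)=\sum_{i=0}^n\kappa_{n-i}V_i(K)\,\epsilon^{n-i},$$ where $\mathrm{vol}$ is Lebesgue measure on $\mathbb{R}^n$, $+$ is Minkowski (vector) addition, $B_2^n$ is the closed unit Euclidean ball in $\mathbb{R}^n$, and $\kappa_{j}$ is the $j$-dimensional volume of the unit ball $B_2^{j}$ (with $\kappa_0=1$). Two sets are congruent if one is the image of the other under an isometry of $\mathbb{R}^n$. *)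

(* Defs.v *)
From HB Require Import structures.
From mathcomp Require Import all_boot all_order all_algebra.
From mathcomp Require Import all_classical all_reals all_analysis.

Set Implicit Arguments.
Unset Strict Implicit.
Unset Printing Implicit Defensive.
Import Order.TTheory GRing.Theory Num.Theory.
Import numFieldNormedType.Exports.

Local Open Scope classical_set_scope.
Local Open Scope ring_scope.

Section LebesgueTuple.
Variable R : realType.
Local Notation mR := (measurableTypeR R).
Local Open Scope ereal_scope.

Section Step.
Variables (n : nat) (mu : {sigma_finite_measure set (n.-tuple mR) -> \bar R}).

Definition tuple_consp (p : mR * n.-tuple mR) : n.+1.-tuple mR :=
  [the n.+1.-tuple mR of p.1 :: p.2].

Lemma measurable_tuple_consp : measurable_fun setT tuple_consp.
Proof. exact: measurable_cons measurable_fst measurable_snd. Qed.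

Definition lebesgue_tuple_step : set (n.+1.-tuple mR) -> \bar R :=
  pushforward (@lebesgue_measure R \x mu) tuple_consp.

Let measurable_preimage A : measurable A -> measurable (tuple_consp @^-1` A).
Proof.
by move=> mA; rewrite -[X in measurable X]setTI; exact: measurable_tuple_consp.
Qed.

Let lebesgue_tuple_step0 : lebesgue_tuple_step set0 = 0.
Proof. by rewrite /lebesgue_tuple_step /pushforward preimage_set0 measure0. Qed.

Let lebesgue_tuple_step_ge0 A : 0 <= lebesgue_tuple_step A.
Proof. by rewrite /lebesgue_tuple_step /pushforward; exact: measure_ge0. Qed.

Let lebesgue_tuple_step_sigma_additive : semi_sigma_additive lebesgue_tuple_step.
Proof.
move=> F mF tF mUF; rewrite /lebesgue_tuple_step /pushforward preimage_bigcup.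
apply: measure_semi_sigma_additive.
- by move=> i; exact: measurable_preimage.
- apply/trivIsetP => /= i j _ _ ij; rewrite -preimage_setI.
  by move/trivIsetP : tF => /(_ _ _ _ _ ij) ->//; rewrite preimage_set0.
- by rewrite -preimage_bigcup; exact: measurable_preimage.
Qed.

HB.instance Definition _ := isMeasure.Build _ _ _ lebesgue_tuple_step
  lebesgue_tuple_step0 lebesgue_tuple_step_ge0 lebesgue_tuple_step_sigma_additive.

Let lebesgue_tuple_step_sigma_finite : sigma_finite setT lebesgue_tuple_step.
Proof.
have /sigma_finiteP[F [FT ndF Foo]] := sigma_finiteT (@lebesgue_measure R).
have /sigma_finiteP[G [GT ndG Goo]] := sigma_finiteT mu.
pose g (t : n.+1.-tuple mR) : mR * n.-tuple mR := (thead t, [tuple of behead t]).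
have mg : measurable_fun setT g.
  apply/measurable_fun_pairP; split => /=.
    exact: measurable_tnth.
  exact: measurable_behead.
have fgK : cancel tuple_consp g.
  by move=> [x t]; rewrite /g; congr pair => //; apply/val_inj.
exists (fun i => g @^-1` (F i `*` G i)).
  rewrite -preimage_bigcup (_ : \bigcup_i _ = setT) ?preimage_setT//.
  rewrite -subTset => -[x t] _.
  have [i _ Fx] : (\bigcup_i F i) x by rewrite -FT.
  have [j _ Gt] : (\bigcup_i G i) t by rewrite -GT.
  exists (maxn i j) => //; split.
  - by move: x Fx; exact/subsetPset/ndF/leq_maxl.
  - by move: t Gt; exact/subsetPset/ndG/leq_maxr.
move=> i; have [mF Fi] := Foo i; have [mG Gi] := Goo i; split.
  by rewrite -[X in measurable X]setTI; apply: mg => //; exact: measurableX.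
rewrite /lebesgue_tuple_step /pushforward -comp_preimage.
rewrite (_ : g \o tuple_consp = id); last by apply/funext => p /=; rewrite fgK.
by rewrite preimage_id product_measure1E// lte_mul_pinfty// ge0_fin_numE.
Qed.

HB.instance Definition _ := Measure_isSigmaFinite.Build _ _ _ lebesgue_tuple_step
  lebesgue_tuple_step_sigma_finite.

End Step.

(* n-fold product of the Lebesgue measure on the line, on n.-tuples; for n = 0
   it is the unit mass on the empty tuple, hence kappa 0 = 1 below. *)
Fixpoint lebesgue_tuple (n : nat) :
    {sigma_finite_measure set (n.-tuple mR) -> \bar R} :=
  match n with
  | 0 => \d_([tuple])
  | m.+1 => lebesgue_tuple_step (lebesgue_tuple m)
  end.

End LebesgueTuple.

(* Sanity check: boxes get the product of the lengths of their sides. *)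
Lemma lebesgue_tuple_box (R : realType) (n : nat) (A : 'I_n -> set (measurableTypeR R)) :
  (forall i, measurable (A i)) ->
  lebesgue_tuple R n [set t | forall i, A i (tnth t i)] =
  (\prod_(i < n) lebesgue_measure (A i))%E.
Proof.
elim: n A => [|n IHn] A mA.
  rewrite big_ord0 /= diracE mem_set// => -[] //.
rewrite big_ord_recl /=; rewrite /lebesgue_tuple_step /pushforward.
rewrite (_ : _ @^-1` _ =
  A ord0 `*` [set t : n.-tuple (measurableTypeR R) |
    forall i, A (lift ord0 i) (tnth t i)]); last first.
  apply/seteqP; split => -[x t] /=.
    move=> At; split=> [|i]; first exact: (At ord0).
    by have := At (lift ord0 i); rewrite /tuple_consp tnthS.
  move=> [Ax At] i; have [j ->|->] := unliftP ord0 i.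
    by rewrite /tuple_consp tnthS.
  by rewrite /tuple_consp tnth0.
rewrite product_measure1E//; first by rewrite (IHn (fun i => A (lift ord0 i))).
rewrite (_ : [set t | _] =
  \bigcap_(i in [set: 'I_n]) (fun t => tnth t i) @^-1` A (lift ord0 i)).
  apply: fin_bigcap_measurable => // i _.
  by rewrite -[X in measurable X]setTI; exact: measurable_tnth.
by apply/seteqP; split => t /= At i; [move=> _|]; exact: At.
Qed.

Section IntrinsicVolumes.
Variable R : realType.

(* [lebesgue_tuple] lives on tuples, which carry the product sigma-algebra;
   row vectors carry the vector space structure. *)
Definition vol (n : nat) (A : set 'rV[R]_n) : \bar R :=
  lebesgue_tuple R n [set t | A (\row_i tnth t i)].

(* The library norm on matrices is the sup norm. *)
Definition enorm (n : nat) (x : 'rV[R]_n) : R :=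
  Num.sqrt (\sum_(i < n) x ord0 i ^+ 2).

Definition unit_ball (n : nat) : set 'rV[R]_n := [set x | enorm x <= 1].

Definition kappa (n : nat) : R := fine (vol (@unit_ball n)).

Definition steiner_formula (n : nat) (K : set 'rV[R]_n) (V : nat -> R) : Prop :=
  forall eps : R, 0 < eps ->
    vol [set x + eps *: y | x in K & y in @unit_ball n] =
    (\sum_(i < n.+1) kappa (n - i) * V i * eps ^+ (n - i))%:E.

(* The Steiner formula determines V i for i <= n only; the values returned for
   i > n, or when K satisfies no Steiner formula, are meaningless. *)
Definition intrinsic_volume (n : nat) (i : nat) (K : set 'rV[R]_n) : R :=
  xget (fun=> 0) [set V | steiner_formula K V] i.

(* Distance preservation already forces bijectivity in finite dimension. *)
Definition euclidean_isometry (n : nat) (f : 'rV[R]_n -> 'rV[R]_n) : Prop :=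
  forall x y, enorm (f x - f y) = enorm (x - y).

Definition congruent (n : nat) (A B : set 'rV[R]_n) : Prop :=
  exists f, euclidean_isometry f /\ B = f @` A.

(* The distinguished (last) coordinate is the one of index n - 1. *)
Definition std_ellipsoid_of_revolution (n : nat) (a b : R) : set 'rV[R]_n :=
  [set x | \sum_(i < n)
      x ord0 i ^+ 2 / (if i.+1 == n then b else a) ^+ 2 <= 1].

Definition ellipsoid_of_revolution (n : nat) (E : set 'rV[R]_n) : Prop :=
  exists a b : R, [/\ 0 < a, 0 < b &
    exists f, euclidean_isometry f /\ E = f @` std_ellipsoid_of_revolution a b].

End IntrinsicVolumes.

(* Main.v *)
Require Import Defs.
From HB Require Import structures.
From mathcomp Require Import all_boot all_order perm all_algebra.
From mathcomp Require Import all_classical all_reals all_analysis.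
From mathcomp Require Import ring lra zify.
Import Order.TTheory GRing.Theory Num.Theory.
Import numFieldNormedType.Exports.
Set Implicit Arguments.
Unset Strict Implicit.
Unset Printing Implicit Defensive.
Local Open Scope classical_set_scope.
Local Open Scope ring_scope.

(** Consider an ellipsoid with semiaxes [a] (in [n - 1] directions) and [b], and
    parametrize its boundary by the outer normal, whose axial component is [a u]
    when the radial one has length 1. The boundary of the parallel body at
    distance [e] has a section of radius [radius u] at height [height u], both
    explicit and affine in [e]. Integrating [radius u ^ (n - 1)] against
    [height] and expanding in powers of [e] gives the Steiner formula
    ([steiner_axial_ellipsoid]): up to a constant depending on [n] and [i], the
    [i]-th intrinsic volume is [a ^ (i - 1)] times the integral over the
    half-line of [(1 - profile u) / u ^ 2], where
    [profile u = (1 + a^2 u^2) ^ (- (n - i) / 2) * (1 + b^2 u^2) ^ (- i / 2)].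

    This integral is homogeneous of degree 1 in the pair [(a, b)]. Fixing the
    volume amounts to fixing [c] with [c ^ n = a ^ (n - 1) * b], and by
    homogeneity the [i]-th intrinsic volume becomes [c ^ i * j_i t], with
    [t = a / c] and [j_i] the functional for the semiaxes [t ^ i] and
    [t ^ (i - n)] ([shape_functional]). Three facts determine [t]:
    - [j_(n - i) t = j_i (1 / t)], since exchanging the two semiaxes exchanges
      the exponents of the profile ([shape_functionalV]);
    - [j_i] is strictly increasing for [t >= 1], because the profile decreases
      pointwise ([shape_functional_increasing]); by the first fact it is
      strictly decreasing for [t <= 1];
    - [j_k t < j_k (1 / t)] for [t > 1] and [k < n / 2] ([shape_functional_ltV]).
      The substitution [u := 1 / u] exchanges the two profiles up to the factor
      [u ^ n] and folds the integral of their difference to the unit interval,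
      where the sign follows from a discrete log-convexity.
    If [t1 < 1 < t2] gave the same values of [j_k] and of [j_(n - k)], then the
    third fact for [1 / t1] and for [t2] would yield two opposite strict
    inequalities ([shape_determined_pair]). Equal values of [j_(n / 2)] force
    [t2 = 1 / t1] instead, which the third fact excludes for [k] or for [n - k]
    ([shape_determined_half]).

    For volumes, the body is cut into slabs perpendicular to its axis, each
    enclosed between two cylinders, so that no integral over sections is
    needed. That volumes do not depend on the position of the ellipsoid follows
    from the uniqueness of translation-invariant measures
    ([lebesgue_tuple_linear]). Improper integrals are handled as suprema of
    primitives with explicit error bounds. *)

(** * Invariance of the Lebesgue measure on tuples *)

Section LebesgueTupleInvariance.
Variable R : realType.
Local Notation mR := (measurableTypeR R).
Local Notation leb n := (lebesgue_tuple R n).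

Definition row_of n (t : n.-tuple mR) : 'rV[R]_n := \row_i tnth t i.
Definition tuple_of n (x : 'rV[R]_n) : n.-tuple mR := [tuple (x ord0 i : mR) | i < n].

Lemma tuple_ofK n : cancel (@tuple_of n) (@row_of n).
Proof. by move=> x; apply/rowP => i; rewrite mxE tnth_mktuple. Qed.

Lemma measurable_coord d (T : measurableType d) n (f : T -> 'rV[R]_n) :
  (forall i, measurable_fun setT (fun t => f t ord0 i : mR)) ->
  measurable_fun setT (fun t => tuple_of (f t)).
Proof.
move=> mf; apply/measurable_fun_tnthP => i.
by rewrite (_ : _ \o _ = fun t => f t ord0 i : mR)//; apply/funext => t /=; rewrite tnth_mktuple.
Qed.

Lemma measurable_row_of n (i : 'I_n) :
  measurable_fun setT (fun t : n.-tuple mR => row_of t ord0 i : mR).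
Proof.
rewrite (_ : (fun _ => _) = fun t : n.-tuple mR => tnth t i).
  exact: measurable_tnth.
by apply/funext => t; rewrite mxE.
Qed.

Lemma lebesgue_measure_translate (c : R) (A : set mR) : measurable A ->
  lebesgue_measure ((fun x => x + c) @^-1` A) = @lebesgue_measure R A.
Proof.
move=> mA.
have mf : measurable_fun setT ((fun x => x + c) : mR -> mR).
  by apply: measurable_realfun.measurable_funD => //; exact: measurable_cst.
have -> : lebesgue_measure ((fun x => x + c) @^-1` A) =
  pushforward (@lebesgue_measure R) ((fun x => x + c) : mR -> mR) A by [].
apply/esym; apply: (@lebesgue_measure_unique R
  (pushforward (@lebesgue_measure R) ((fun x => x + c) : mR -> mR))) => // X.
case=> -[a b] /= _ <-; rewrite /pushforward.
rewrite (_ : _ @^-1` _ = [set` `]a - c, b - c]]); last first.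
  by apply/seteqP; split => x /=; rewrite !in_itv /= ltrBlDr lerBrDr.
rewrite !lebesgue_measure_itv /= !lte_fin ltrD2r; case: ifP => // _.
by rewrite -!EFinB; congr (_%:E); ring.
Qed.

(** A translation acts separately on the first coordinate and on the others,
    and a product measure is determined by its values on rectangles. *)
Lemma lebesgue_tuple_translate n (c : 'rV[R]_n) (A : set (n.-tuple mR)) :
  measurable A ->
  leb n ((fun t => tuple_of (row_of t + c)) @^-1` A) = leb n A.
Proof.
elim: n c A => [|n IHn] c A mA.
  by congr (lebesgue_tuple _ _ _); apply/seteqP; split => t /=; rewrite (tuple0 (tuple_of _)) (tuple0 t).
pose f (p : mR * n.-tuple mR) : mR * n.-tuple mR :=
  (p.1 + c ord0 ord0, tuple_of (row_of p.2 + \row_i c ord0 (lift ord0 i))).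
have mf2 : measurable_fun setT (fun t : n.-tuple mR => tuple_of (row_of t + \row_i c ord0 (lift ord0 i))).
  apply: measurable_coord => i.
  under eq_fun do rewrite mxE.
  apply: measurable_realfun.measurable_funD; last exact: measurable_cst.
  exact: measurable_row_of.
have mf1 : measurable_fun setT (fun x : mR => x + c ord0 ord0 : mR).
  by apply: measurable_realfun.measurable_funD => //; exact: measurable_cst.
have mf : measurable_fun setT f.
  apply/measurable_fun_pairP; split => /=.
    exact: (measurableT_comp mf1 measurable_fst).
  exact: (measurableT_comp mf2 measurable_snd).
pose mu := (@lebesgue_measure R \x leb n)%E.
have mcA : measurable (@tuple_consp R n @^-1` A).
  by rewrite -[X in measurable X]setTI; exact: measurable_tuple_consp.
have muf X : measurable X -> mu X = pushforward mu f X.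
  apply: (@product_measure_unique _ _ _ _ _ _ _ (pushforward mu f)) => B C mB mC.
  transitivity (mu (((fun x : mR => x + c ord0 ord0) @^-1` B) `*`
    ((fun t : n.-tuple mR => tuple_of (row_of t + \row_i c ord0 (lift ord0 i))) @^-1` C))) => //.
  rewrite /mu product_measure1E//; last 2 first.
  - by rewrite -[X in measurable X]setTI; exact: mf1.
  - by rewrite -[X in measurable X]setTI; exact: mf2.
  by congr (_ * _)%E; [exact: lebesgue_measure_translate|exact: IHn].
rewrite /= /lebesgue_tuple_step /pushforward -/mu [RHS]muf// /pushforward.
have consE p : tuple_of (row_of (tuple_consp p) + c) = tuple_consp (f p).
  apply: eq_from_tnth => i; rewrite tnth_mktuple !mxE.
  by case: (unliftP ord0 i) => [j|] ->; rewrite ?tnthS ?tnth0 /f /= ?tnth_mktuple ?mxE.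
by congr (mu _); apply/seteqP; split => p /=; rewrite consE.
Qed.

End LebesgueTupleInvariance.

Section LebesgueTupleLinear.
Variable R : realType.
Local Notation mR := (measurableTypeR R).
Local Notation leb n := (lebesgue_tuple R n).

Lemma measurable_setP d (T : measurableType d) d' (U : measurableType d') (f : T -> U) (A : set U) :
  measurable_fun setT f -> measurable A -> measurable (f @^-1` A).
Proof. by move=> mf mA; rewrite -[X in measurable X]setTI; exact: mf. Qed.

(** Tonelli's theorem for an indicator function, in terms of sections. *)
Lemma integral_section_swap d (T : measurableType d) (mu : {sigma_finite_measure set T -> \bar R})
    (W : set (T * T)) : measurable W ->
  (\int[mu]_x mu [set y | W (x, y)] = \int[mu]_y mu [set x | W (x, y)])%E.
Proof.
move=> mW.
have Ex x : xsection W x = [set y | W (x, y)].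
  by apply/seteqP; split => y /=; rewrite /xsection /= inE.
have Ey y : ysection W y = [set x | W (x, y)].
  by apply/seteqP; split => x /=; rewrite /ysection /= inE.
transitivity ((mu \x mu) W)%E.
  by apply: eq_integral => x _; rewrite -Ex.
rewrite (@product_measure_unique _ _ _ _ _ mu mu (mu \x^ mu)%E)//.
  by apply: eq_integral => x _; rewrite -Ey.
by move=> B C mB mC; exact: product_measure2E.
Qed.

Lemma measurable_linear n (M : 'M[R]_n) :
  measurable_fun setT (fun t : n.-tuple mR => tuple_of (row_of t *m M)).
Proof.
apply: measurable_coord => i.
under eq_fun do rewrite mxE.
apply: (@measurable_sum _ _ R _ _ _ (fun k (t : n.-tuple mR) => row_of t ord0 k * M k i)) => k.
apply: measurable_realfun.measurable_funM; last exact: measurable_cst.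
exact: measurable_row_of.
Qed.

(** Up to a factor, a translation-invariant measure is unique: applied to
    [A |-> leb n (phi @^-1` A)] with [phi : y |-> y M], this determines the
    effect of a linear map on volumes from its effect on a single set [B].
    Both sides compute the integral of [(x, y) |-> 1_A x * 1_B (y M - x)]: over
    [y] first, a translation absorbs [x] and leaves the product on the left;
    over [x] first, the translation [x := x + y M] exchanges the roles. *)
Lemma lebesgue_tuple_linear n (M : 'M[R]_n) (A B : set (n.-tuple mR)) :
  M \in unitmx -> measurable A -> measurable B ->
  (leb n A * leb n ((fun t => tuple_of (row_of t *m M)) @^-1` B) =
   leb n ((fun t => tuple_of (row_of t *m M)) @^-1` A) *
   leb n ((fun t => tuple_of (- row_of t)) @^-1` B))%E.
Proof.
move=> uM mA mB; set phi : n.-tuple mR -> n.-tuple mR := fun t => tuple_of (row_of t *m M).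
have mphi : measurable_fun setT phi by exact: measurable_linear.
have mneg : measurable_fun setT (fun t : n.-tuple mR => tuple_of (- row_of t)).
  apply: measurable_coord => i; under eq_fun do rewrite mxE.
  by apply: measurable_realfun.measurable_funN; exact: measurable_row_of.
pose T := n.-tuple mR.
have mrow i : measurable_fun setT (fun p : T * T => row_of p.1 ord0 i : mR).
  exact: (measurableT_comp (measurable_row_of i) measurable_fst).
have mrphi i : measurable_fun setT (fun p : T * T => row_of (phi p.2) ord0 i : mR).
  exact: (measurableT_comp (measurable_row_of i) (measurableT_comp mphi measurable_snd)).
pose W := [set p : T * T | A p.1 /\ B (tuple_of (row_of (phi p.2) - row_of p.1))].
pose W' := [set p : T * T | A (tuple_of (row_of p.1 + row_of (phi p.2))) /\ B (tuple_of (- row_of p.1))].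
have mW : measurable W.
  apply: measurableI.
    exact: (measurable_setP measurable_fst mA).
  apply: (measurable_setP (f := fun p : T * T => tuple_of (row_of (phi p.2) - row_of p.1)) _ mB).
  apply: measurable_coord => i; under eq_fun do rewrite mxE.
  apply: measurable_realfun.measurable_funD; first exact: mrphi.
  under eq_fun do rewrite mxE.
  by apply: measurable_realfun.measurable_funN; exact: mrow.
have mW' : measurable W'.
  apply: measurableI.
    apply: (measurable_setP (f := fun p : T * T => tuple_of (row_of p.1 + row_of (phi p.2))) _ mA).
    apply: measurable_coord => i; under eq_fun do rewrite mxE.
    by apply: measurable_realfun.measurable_funD; [exact: mrow|exact: mrphi].
  exact: (measurable_setP (measurableT_comp mneg measurable_fst) mB).
have E1 x : leb n [set y | W (x, y)] = ((\1_A x)%:E * leb n (phi @^-1` B))%E.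
  rewrite indicE; have [xA|xA] := boolP (x \in A).
    rewrite mul1e -[RHS](@lebesgue_tuple_translate R n (- (row_of x *m invmx M))); last first.
      exact: measurable_setP.
    congr (leb n _); apply/seteqP; split => y /=; rewrite /W /phi /= !tuple_ofK.
      by move=> [_]; rewrite mulmxDl mulNmx mulmxKV.
    by rewrite mulmxDl mulNmx mulmxKV// => yB; split => //; exact/set_mem.
  rewrite mul0e (_ : [set _ | _] = set0) ?measure0//.
  by apply/seteqP; split => // y [/= Ax _]; move/negP: xA; apply; exact/mem_set.
have E2 y : leb n [set x | W (x, y)] = leb n [set x | W' (x, y)].
  rewrite -[LHS](@lebesgue_tuple_translate R n (row_of (phi y))); last first.
    exact: (measurable_setP (f := fun x : T => (x, y)) (measurable_pair2 y) mW).
  congr (leb n _); apply/seteqP; split => x /=; rewrite /W /W' /= !tuple_ofK.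
    by rewrite opprD addrCA subrr addr0.
  by rewrite opprD addrCA subrr addr0.
have E3 x : leb n [set y | W' (x, y)] =
    ((\1_((fun t => tuple_of (- row_of t)) @^-1` B) x)%:E * leb n (phi @^-1` A))%E.
  rewrite indicE; have [xB|xB] := boolP (x \in _).
    rewrite mul1e -[RHS](@lebesgue_tuple_translate R n (row_of x *m invmx M)); last first.
      exact: measurable_setP.
    have xB' := set_mem xB.
    congr (leb n _); apply/seteqP; split => y /=; rewrite /W' /phi /= !tuple_ofK.
      by move=> [+ _]; rewrite mulmxDl mulmxKV// addrC.
    by rewrite mulmxDl mulmxKV// addrC => yA; split.
  rewrite mul0e (_ : [set _ | _] = set0) ?measure0//.
  by apply/seteqP; split => // y [/= _ Bx]; move/negP: xB; apply; exact/mem_set.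
have Zr (C : set T) (c : \bar R) : measurable C -> (0 <= c)%E ->
    (\int[leb n]_x ((\1_C x)%:E * c) = leb n C * c)%E.
  move=> mC c0; rewrite ge0_integralZr//.
  - by rewrite integral_indic// setIT.
  - exact/measurable_realfun.measurable_EFinP/measurable_realfun.measurable_indic.
have := integral_section_swap (leb n) mW.
under eq_integral do rewrite E1.
under [RHS]eq_integral do rewrite E2.
rewrite -integral_section_swap//.
under [RHS]eq_integral do rewrite E3.
rewrite !Zr//; last exact: measurable_setP.
by rewrite [RHS]muleC.
Qed.

End LebesgueTupleLinear.

(** * Euclidean isometries preserve volume *)

Section IsometryVolume.
Variable R : realType.
Local Notation mR := (measurableTypeR R).
Local Notation leb n := (lebesgue_tuple R n).

Definition eball n (r : R) : set 'rV[R]_n := [set x | enorm x <= r].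

Lemma enorm_ge0 n (x : 'rV[R]_n) : 0 <= enorm x.
Proof. exact: sqrtr_ge0. Qed.

Lemma sqr_enorm n (x : 'rV[R]_n) : enorm x ^+ 2 = \sum_(i < n) x ord0 i ^+ 2.
Proof. by rewrite sqr_sqrtr// sumr_ge0// => i _; exact: sqr_ge0. Qed.

Lemma enorm_le n (x : 'rV[R]_n) (r : R) : 0 <= r ->
  (enorm x <= r) = (\sum_(i < n) x ord0 i ^+ 2 <= r ^+ 2).
Proof. by move=> r0; rewrite -sqr_enorm ler_pXn2r// ?nnegrE ?enorm_ge0. Qed.

Lemma sqr_enorm_mx n (x : 'rV[R]_n) : enorm x ^+ 2 = (x *m x^T) ord0 ord0.
Proof. by rewrite sqr_enorm mxE; apply: eq_bigr => i _; rewrite mxE expr2. Qed.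

Lemma enormZ n (c : R) (x : 'rV[R]_n) : enorm (c *: x) = `|c| * enorm x.
Proof.
apply/eqP; rewrite -(@eqrXn2 _ 2)// ?enorm_ge0 ?mulr_ge0 ?enorm_ge0//.
rewrite exprMn real_normK ?num_real// !sqr_enorm mulr_sumr; apply/eqP.
by apply: eq_bigr => i _; rewrite mxE exprMn.
Qed.

Lemma enormN n (x : 'rV[R]_n) : enorm (- x) = enorm x.
Proof. by rewrite -scaleN1r enormZ normrN normr1 mul1r. Qed.

Lemma measurable_enorm n : measurable_fun setT (fun t : n.-tuple mR => enorm (row_of t) : mR).
Proof.
have m1 : measurable_fun setT (fun t : n.-tuple mR => \sum_(i < n) row_of t ord0 i ^+ 2 : mR).
  apply: (@measurable_sum _ _ R _ _ _ (fun i (t : n.-tuple mR) => row_of t ord0 i ^+ 2)) => i.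
  by apply: measurable_realfun.measurable_funX; exact: measurable_row_of.
apply: (measurableT_comp (f := @Num.sqrt R : mR -> mR)) m1.
by apply: measurable_realfun.continuous_measurable_fun; exact: sqrt_continuous.
Qed.

Lemma measurable_eball n r : measurable [set t : n.-tuple mR | eball r (row_of t)].
Proof.
rewrite (_ : [set _ | _] = (fun t : n.-tuple mR => enorm (row_of t) : mR) @^-1` [set` `]-oo, r]]).
  by apply: (measurable_setP (@measurable_enorm n)); exact: measurable_itv.
by apply/seteqP; split => t /=; rewrite in_itv.
Qed.

Definition cube n (r : R) : set (n.-tuple mR) := [set t | forall i, tnth t i \in `[- r, r]].

Lemma measurable_cube n r : measurable (@cube n r).
Proof.
rewrite /cube (_ : [set t | _] =
  \bigcap_(i in [set: 'I_n]) (fun t : n.-tuple mR => tnth t i) @^-1` [set` `[- r, r]]).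
  apply: fin_bigcap_measurable => // i _.
  by apply: (measurable_setP (@measurable_tnth _ _ _ i)); exact: measurable_itv.
by apply/seteqP; split => t /= At i; [move=> _|]; exact: At.
Qed.

Lemma lebesgue_cube n r : 0 <= r -> leb n (@cube n r) = ((2 * r) ^+ n)%:E.
Proof.
move=> r0; rewrite (@lebesgue_tuple_box R n (fun=> [set` `[- r, r]])); last first.
  by move=> i; exact: measurable_itv.
have -> : lebesgue_measure ([set` `[- r, r]] : set mR) = (2 * r)%:E.
  rewrite lebesgue_measure_itv /= lte_fin; case: ltP => [_|rr].
    by rewrite -EFinB; congr EFin; ring.
  by congr EFin; lra.
by rewrite -(big_mkord xpredT (fun=> (2 * r)%:E)) prodEFin prodr_const_nat subn0.
Qed.

Lemma eball_sub_cube n r (t : n.-tuple mR) : eball r (row_of t) -> @cube n r t.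
Proof.
rewrite /eball /= => tr i.
rewrite in_itv /= -ler_norml; apply: le_trans tr.
rewrite -(@ler_pXn2r _ 2)// ?nnegrE ?enorm_ge0// real_normK ?num_real//.
rewrite sqr_enorm (bigD1 i)//= mxE lerDl sumr_ge0// => j _; exact: sqr_ge0.
Qed.

(** The half-side [r / (n + 1)] is small enough for the inclusion and makes
   sense in dimension 0. *)
Lemma cube_sub_eball n (t : n.-tuple mR) r : 0 <= r -> @cube n (r / n.+1%:R) t -> eball r (row_of t).
Proof.
move=> r0 ct; rewrite /eball /= enorm_le//.
have n0 : 0 < n.+1%:R :> R by rewrite ltr0n.
apply: (@le_trans _ _ (\sum_(i < n) (r / n.+1%:R) ^+ 2)).
  apply: ler_sum => i _; rewrite mxE -(real_normK (num_real (tnth t i))).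
  by rewrite ler_pXn2r ?nnegrE ?divr_ge0 ?ler0n// ler_norml; have := ct i; rewrite in_itv.
rewrite sumr_const card_ord -[leLHS]mulr_natl expr_div_n mulrCA ler_piMr ?sqr_ge0//.
rewrite expr2 invfM mulrA ler_pdivrMr// mul1r ler_pdivrMr//.
have : n%:R <= n.+1%:R :> R by rewrite ler_nat.
have : 1 <= n.+1%:R :> R by rewrite ler1n.
nra.
Qed.

Lemma lebesgue_eball_fin n r : 0 <= r -> leb n [set t | eball r (row_of t)] \is a fin_num.
Proof.
move=> r0; rewrite ge0_fin_numE ?measure_ge0//.
apply: (@le_lt_trans _ _ (leb n (@cube n r))).
  by apply: le_measure; rewrite ?inE; [exact: measurable_eball|exact: measurable_cube|exact: eball_sub_cube].
by rewrite lebesgue_cube// ltry.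
Qed.

Lemma lebesgue_eball_gt0 n r : 0 < r -> (0 < leb n [set t | eball r (row_of t)])%E.
Proof.
move=> r0; apply: (@lt_le_trans _ _ (leb n (@cube n (r / n.+1%:R)))).
  by rewrite lebesgue_cube ?divr_ge0 ?ltW// lte_fin exprn_gt0// mulr_gt0// divr_gt0.
apply: le_measure; rewrite ?inE; [exact: measurable_cube|exact: measurable_eball|].
by move=> t; apply: cube_sub_eball; exact: ltW.
Qed.

Lemma kappa_gt0 n : 0 < kappa R n.
Proof. by rewrite fine_gt0// lebesgue_eball_gt0//= ltey_eq lebesgue_eball_fin. Qed.

(** The factor of the homothety of ratio [r] is read off a cube. *)
Lemma lebesgue_eball n r : 0 < r -> leb n [set t | eball r (row_of t)] = (kappa R n * r ^+ n)%:E.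
Proof.
move=> r0.
have uM : (r^-1)%:M \in @unitmx R n.
  by case: (n) => [|m]; rewrite ?flatmx0 unitmxE ?det_mx00 ?unitr1// det_scalar unitrX// unitfE invr_eq0 gt_eqF.
have := lebesgue_tuple_linear uM (@measurable_eball n 1) (@measurable_cube n 1).
have ri : 0 <= r^-1 by rewrite invr_ge0 ltW.
have -> : (fun t : n.-tuple mR => tuple_of (row_of t *m (r^-1)%:M)) @^-1`
    [set t | eball 1 (row_of t)] = [set t | eball r (row_of t)].
  apply/seteqP; split => t /=; rewrite tuple_ofK mul_mx_scalar /eball /= enormZ ger0_norm//.
    by rewrite mulrC ler_pdivrMr// mul1r.
  by rewrite mulrC ler_pdivrMr// mul1r.
have -> : (fun t : n.-tuple mR => tuple_of (row_of t *m (r^-1)%:M)) @^-1` @cube n 1 = @cube n r.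
  apply/seteqP; split => t /= h i; have := h i; rewrite tnth_mktuple mul_mx_scalar !mxE !in_itv /=.
    by rewrite mulrC ler_pdivlMr// ler_pdivrMr// mulN1r mul1r.
  by rewrite mulrC ler_pdivlMr// ler_pdivrMr// mulN1r mul1r.
have -> : (fun t : n.-tuple mR => tuple_of (- row_of t)) @^-1` @cube n 1 = @cube n 1.
  apply/seteqP; split => t /= h i; have := h i; rewrite tnth_mktuple !mxE !in_itv /=.
    by rewrite lerNr opprK andbC lerNl.
  by rewrite lerNr opprK andbC lerNl.
rewrite !lebesgue_cube ?ltW//.
have := lebesgue_eball_fin n (@ler01 R).
have := lebesgue_eball_fin n (ltW r0).
rewrite /kappa /vol -/(eball 1) => /fineK <- /fineK <- /=.
rewrite -!EFinM => -[] h; congr EFin.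
have p0 : (2 * 1) ^+ n != 0 :> R by rewrite expf_neq0// mulr1 pnatr_eq0.
by apply: (mulIf p0); rewrite -h !exprMn expr1n; ring.
Qed.

(** The factor of an orthogonal map is 1, because it preserves the unit ball. *)
Lemma lebesgue_tuple_orthogonal n (M : 'M[R]_n) (A : set (n.-tuple mR)) :
  M *m M^T = 1%:M -> measurable A ->
  leb n ((fun t => tuple_of (row_of t *m M)) @^-1` A) = leb n A.
Proof.
move=> oM mA; have [uM _] := mulmx1_unit oM.
have := lebesgue_tuple_linear uM mA (@measurable_eball n 1).
have nM (x : 'rV[R]_n) : enorm (x *m M) = enorm x.
  apply/eqP; rewrite -(@eqrXn2 _ 2)// ?enorm_ge0//.
  by rewrite !sqr_enorm_mx trmx_mul mulmxA -(mulmxA x) oM mulmx1.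
rewrite (_ : _ @^-1` [set t | eball 1 (row_of t)] = [set t | eball 1 (row_of t)]); last first.
  by apply/seteqP; split => t /=; rewrite tuple_ofK /eball /= nM.
rewrite (_ : (fun t => tuple_of (- row_of t)) @^-1` [set t | eball 1 (row_of t)] = [set t | eball 1 (row_of t)]); last first.
  by apply/seteqP; split => t /=; rewrite tuple_ofK /eball /= enormN.
rewrite -(fineK (lebesgue_eball_fin n (@ler01 R))).
set c := fine _.
have c0 : 0 < c by exact: kappa_gt0.
move=> h; apply/esym.
have /(congr1 (fun x => x * (c^-1)%:E)%E) := h.
by rewrite -!muleA -EFinM divff ?gt_eqF// !mule1.
Qed.

(** Polarization makes the translate of [f] fixing the origin preserve inner
    products; its matrix then has the images of the basis vectors as rows. *)
Lemma isometryE n (f : 'rV[R]_n -> 'rV[R]_n) : euclidean_isometry f ->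
  exists2 M : 'M[R]_n, M *m M^T = 1%:M & forall x, f x = f 0 + x *m M.
Proof.
move=> isof; pose g x := f x - f 0.
have gn x : enorm (g x) = enorm x by rewrite isof subr0.
have gB x y : enorm (g x - g y) = enorm (x - y) by rewrite /g opprB addrA subrK isof.
have dot (x y : 'rV[R]_n) : (x *m y^T) ord0 ord0 = (enorm x ^+ 2 + enorm y ^+ 2 - enorm (x - y) ^+ 2) / 2.
  rewrite !sqr_enorm -big_split -sumrB /= mulr_suml mxE; apply: eq_bigr => i _.
  by rewrite !mxE; field.
have gdot x y : (g x *m (g y)^T) ord0 ord0 = (x *m y^T) ord0 ord0 by rewrite !dot !gn gB.
pose M := \matrix_(i < n) g (delta_mx ord0 i).
have oM : M *m M^T = 1%:M.
  apply/matrixP => i j.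
  transitivity ((g (delta_mx ord0 i) *m (g (delta_mx ord0 j))^T) ord0 ord0).
    by rewrite !mxE; apply: eq_bigr => k _; rewrite !mxE.
  by rewrite gdot trmx_delta mul_delta_mx_cond mulmxnE !mxE !eqxx.
exists M => // x; rewrite -[LHS](subrK (f 0)) addrC; congr (_ + _).
have gM : g x *m M^T = x.
  apply/rowP => j.
  transitivity ((g x *m (g (delta_mx ord0 j))^T) ord0 ord0).
    by rewrite !mxE; apply: eq_bigr => k _; rewrite !mxE.
  by rewrite gdot trmx_delta -colE mxE.
by rewrite -{2}gM -mulmxA (mulmx1C oM) mulmx1.
Qed.

Lemma volE n (A : set 'rV[R]_n) : vol A = leb n [set t | A (row_of t)].
Proof. by []. Qed.

Lemma vol_isometry n (f : 'rV[R]_n -> 'rV[R]_n) (A : set 'rV[R]_n) :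
  euclidean_isometry f -> measurable [set t : n.-tuple mR | A (row_of t)] ->
  vol (f @` A) = vol A.
Proof.
move=> /isometryE[M oM fE] mA; have oM' := mulmx1C oM.
rewrite !volE.
rewrite -[RHS](@lebesgue_tuple_orthogonal n M^T) ?trmxK//.
rewrite -[RHS](@lebesgue_tuple_translate R n (- f 0)); last first.
  exact: (measurable_setP (measurable_linear _)).
congr (leb n _); apply/seteqP; split => t /=.
  move=> [x Ax]; rewrite fE !tuple_ofK => <-.
  by rewrite addrAC subrr add0r -mulmxA oM mulmx1.
rewrite !tuple_ofK => At; exists ((row_of t - f 0) *m M^T) => //.
by rewrite fE -mulmxA oM' mulmx1 addrC subrK.
Qed.

End IsometryVolume.

(** * One-variable calculus *)

Section Calculus.
Variable R : realType.
Implicit Types (f g : R -> R) (x : R).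

Lemma is_derive_ext f g x d : f =1 g -> is_derive x 1 f d -> is_derive x 1 g d.
Proof. by move=> /funext ->. Qed.

Lemma deriv_cst (c : R) x : is_derive x 1 (fun=> c) 0.
Proof. exact: is_derive_cst. Qed.

Lemma deriv_id x : is_derive x 1 (fun y : R => y) 1.
Proof. exact: is_derive_id. Qed.

Lemma deriv_add f g x df dg : is_derive x 1 f df -> is_derive x 1 g dg ->
  is_derive x 1 (fun y => f y + g y) (df + dg).
Proof. by move=> hf hg; exact: is_deriveD. Qed.

Lemma deriv_sub f g x df dg : is_derive x 1 f df -> is_derive x 1 g dg ->
  is_derive x 1 (fun y => f y - g y) (df - dg).
Proof. by move=> hf hg; exact: is_deriveB. Qed.

Lemma deriv_mul f g x df dg : is_derive x 1 f df -> is_derive x 1 g dg ->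
  is_derive x 1 (fun y => f y * g y) (df * g x + f x * dg).
Proof.
move=> hf hg; apply: is_derive_eq (is_deriveM hf hg) _.
by rewrite addrC; congr (_ + _); rewrite mulrC.
Qed.

Lemma deriv_scale (c : R) f x df : is_derive x 1 f df ->
  is_derive x 1 (fun y => c * f y) (c * df).
Proof. by move=> hf; have := deriv_mul (deriv_cst c x) hf; rewrite mul0r add0r. Qed.

Lemma deriv_exp f x df n : is_derive x 1 f df ->
  is_derive x 1 (fun y => f y ^+ n) (n%:R * f x ^+ n.-1 * df).
Proof.
move=> hf; elim: n => [|n IHn].
  by rewrite !mul0r; apply: is_derive_ext (deriv_cst 1 x) => y; rewrite expr0.
apply: (is_derive_ext (f := fun y => f y * f y ^+ n)); first by move=> y; rewrite exprS.
apply: is_derive_eq (deriv_mul hf IHn) _ => /=.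
by case: n {IHn} => [|n]; rewrite /= ?expr0 -?natr1 ?exprS; ring.
Qed.

Lemma deriv_comp f g x df dg : is_derive x 1 g dg -> is_derive (g x) 1 f df ->
  is_derive x 1 (fun y => f (g y)) (df * dg).
Proof. by move=> hg hf; exact: is_derive1_comp. Qed.

Lemma deriv_inv x : x != 0 -> is_derive x 1 (fun y : R => y^-1) (- x ^- 2).
Proof.
move=> x0; apply: is_derive_eq (@is_deriveV R id x 1 1 x0 (is_derive_id x 1)) _.
by rewrite /GRing.scale /= mulr1.
Qed.

Lemma deriv_continuous f x d : is_derive x 1 f d -> {for x, continuous f}.
Proof. by move=> [h _]; apply/differentiable_continuous/derivable1_diffP. Qed.

Lemma mvt f df (a b : R) : a < b -> (forall x, a <= x <= b -> is_derive x 1 f (df x)) ->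
  exists2 c, a < c < b & f b - f a = df c * (b - a).
Proof.
move=> ab hf; have [x||c] := @MVT R f df a b ab.
- by rewrite in_itv /= => /andP[ax xb]; apply: hf; rewrite !ltW.
- apply: continuous_in_subspaceT => y /set_mem /=.
  by rewrite in_itv /= => /hf /deriv_continuous.
- by rewrite in_itv /= => acb E; exists c.
Qed.

(** Derivatives are assumed at the end points as well, which spares all
    continuity side conditions. *)
Lemma deriv_gt0_lt f df (a b : R) : a < b ->
  (forall x, a <= x <= b -> is_derive x 1 f (df x)) ->
  (forall x, a < x < b -> 0 < df x) -> f a < f b.
Proof.
move=> ab hf hd; have [c acb E] := mvt ab hf.
by rewrite -subr_gt0 E mulr_gt0 ?hd// subr_gt0.
Qed.

Lemma deriv_ge0_le f df (a b : R) : a <= b ->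
  (forall x, a <= x <= b -> is_derive x 1 f (df x)) ->
  (forall x, a < x < b -> 0 <= df x) -> f a <= f b.
Proof.
rewrite le_eqVlt => /predU1P[->//|ab] hf hd; have [c acb E] := mvt ab hf.
by rewrite -subr_ge0 E mulr_ge0 ?hd// subr_ge0 ltW.
Qed.

Lemma deriv_eq f g df (a b : R) : a <= b -> f a = g a ->
  (forall x, a <= x <= b -> is_derive x 1 f (df x)) ->
  (forall x, a <= x <= b -> is_derive x 1 g (df x)) -> f b = g b.
Proof.
rewrite le_eqVlt => /predU1P[->//|ab] E hf hg.
have [|c _] := @mvt (fun y => f y - g y) (fun=> 0) a b ab.
  by move=> x xab; apply: is_derive_eq (deriv_sub (hf x xab) (hg x xab)) _; rewrite subrr.
by rewrite mul0r E subrr subr0 => /eqP; rewrite subr_eq0 => /eqP.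
Qed.

Local Notation mu := (@lebesgue_measure R).

(** Integrating from a negative point makes the primitive differentiable at [0] too. *)
Definition primitive f (x : R) : R :=
  (\int[mu]_(t in `[(-1)%R, x]) f t - \int[mu]_(t in `[(-1)%R, 0%R]) f t)%R.

Lemma primitive0 f : primitive f 0 = 0.
Proof. by rewrite /primitive subrr. Qed.

Lemma deriv_primitive f x : continuous f -> 0 <= x -> is_derive x 1 (primitive f) (f x).
Proof.
move=> cf x0.
have [||||d1 d2] := @continuous_FTC1_closed R f (-1) x (x + 1).
- by rewrite ltrDl.
- apply: continuous_compact_integrable; first exact: segment_compact.
  exact: continuous_subspaceT.
- lra.
- exact: cf.
have h1 : is_derive x 1 (fun y => \int[mu]_(t in `[(-1)%R, y]) f t)%R (f x).
  by apply: DeriveDef d1 _; rewrite -derive1E d2.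
by apply: is_derive_eq (deriv_sub h1 (deriv_cst _ x)) _; rewrite subr0.
Qed.

(** A strict inequality survives the passage to the limit [f 0+ = l], since
    [f] still grows strictly beyond any point near [0]. *)
Lemma increasing_lim0_lt f (l C : R) :
  (forall x y, 0 < x -> x < y -> y <= 1 -> f x < f y) ->
  (forall x, 0 < x <= 1 -> `|f x - l| <= C * x) -> l < f 1.
Proof.
move=> incf limf.
have h2 : f 2^-1 < f 1 by apply: incf => //; lra.
apply: le_lt_trans h2; rewrite leNgt; apply/negP => fl.
have C0 : 0 <= C by have := limf 1; rewrite mulr1 => h; apply: le_trans (h _) => //; lra.
pose e := l - f 2^-1; have e0 : 0 < e by rewrite subr_gt0.
pose x := Num.min 4^-1 (e / (C + 1)).
have x0 : 0 < x by rewrite lt_min divr_gt0; lra.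
have x4 : x <= 4^-1 by rewrite ge_min lexx.
have xe : x * (C + 1) <= e by rewrite -ler_pdivlMr ?ge_min ?lexx ?orbT//; lra.
have /limf : 0 < x <= 1 by lra.
have : f x < f 2^-1 by apply: incf => //; lra.
rewrite ler_norml /e in xe *; nra.
Qed.

End Calculus.

(** * Two inequalities between products of powers *)

Section PowerInequalities.
Variable R : realType.

(** The logarithmic derivative of the right-hand side in [t] has the sign of
    [t ^ (i - 1) - t ^ (- m - 1)]. *)
Lemma power_product_increasing (i m : nat) (s t x : R) : (0 < i)%N -> (0 < m)%N ->
  0 < x -> 1 <= s -> s < t ->
  (1 + s ^+ i * x) ^+ m * (1 + s^-1 ^+ m * x) ^+ i <
  (1 + t ^+ i * x) ^+ m * (1 + t^-1 ^+ m * x) ^+ i.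
Proof.
move=> i0 m0 x0 s1 st.
pose A (u : R) := 1 + u ^+ i * x; pose B (u : R) := 1 + u^-1 ^+ m * x.
pose d (u : R) := m%:R * i%:R * x * (A u ^+ m.-1 * B u ^+ i.-1) * (u ^+ i.-1 - u^-1 ^+ m.+1).
have A0 u : 1 <= u -> 0 < A u by move=> u1; rewrite ltr_pwDl// mulr_ge0 ?exprn_ge0//; lra.
have B0 u : 1 <= u -> 0 < B u.
  by move=> u1; rewrite ltr_pwDl// mulr_ge0 ?exprn_ge0 ?invr_ge0//; lra.
apply: (@deriv_gt0_lt R (fun u => A u ^+ m * B u ^+ i) d s t) => // u.
  move=> /andP[su ut]; have u1 : 1 <= u by lra.
  have u0 : u != 0 by rewrite gt_eqF//; lra.
  have dA : is_derive u 1 A (i%:R * u ^+ i.-1 * x).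
    apply: is_derive_eq (deriv_add (deriv_cst 1 u)
      (deriv_mul (deriv_exp i (deriv_id u)) (deriv_cst x u))) _ => /=; ring.
  have dB : is_derive u 1 B (- (m%:R * u^-1 ^+ m.+1 * x)).
    apply: is_derive_eq (deriv_add (deriv_cst 1 u)
      (deriv_mul (deriv_exp m (deriv_inv u0)) (deriv_cst x u))) _ => /=.
    by case: (m) m0 => [//|m'] _; rewrite /= -exprVn !exprS; ring.
  apply: is_derive_eq (deriv_mul (deriv_exp m dA) (deriv_exp i dB)) _ => /=.
  have uv : u * u^-1 = 1 by rewrite divff.
  (* The mixed terms cancel because [u ^ i * u ^ - (m + 1) = u ^ (i - 1) * u ^ - m]. *)
  have key : u ^+ i.-1 * B u - u^-1 ^+ m.+1 * A u = u ^+ i.-1 - u^-1 ^+ m.+1.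
    rewrite exprS; set v := u^-1 in uv *; set y := u ^+ i.-1; set z := v ^+ m.
    rewrite /A /B -/z; have -> : u ^+ i = u * y by rewrite -exprS prednK.
    have -> : v * z * (1 + u * y * x) = v * z + (u * v) * (z * y * x) by ring.
    by rewrite uv; ring.
  have E (y : R) j : (0 < j)%N -> y ^+ j = y * y ^+ j.-1 by move=> j0; rewrite -exprS prednK.
  by rewrite /d -key (E (A u) m)// (E (B u) i)//; ring.
move=> /andP[su ut]; have u1 : 1 < u by lra.
rewrite /d !mulr_gt0 ?ltr0n ?exprn_gt0 ?A0 ?B0 ?ltW// subr_gt0.
apply: (@lt_le_trans _ _ 1); first by rewrite exprn_ilt1 ?invr_ge0 ?invf_lt1//; lra.
by rewrite exprn_ege1// ltW.
Qed.

(** Strict log-convexity with [c 0 = 1] makes the slopes [ln (c j) / j] increase. *)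
Lemma log_convex_powers (c : nat -> R) (k m : nat) : c 0%N = 1 ->
  (forall j, 0 < c j) -> (forall j, c j.+1 ^+ 2 < c j * c j.+2) ->
  (0 < k)%N -> (k < m)%N -> c k ^+ m < c m ^+ k.
Proof.
move=> c0 cp cc k0.
have step j : (0 < j)%N -> c j ^+ j.+1 < c j.+1 ^+ j.
  case: j => // j _; elim: j => [|j IHj].
    by rewrite expr1; have := cc 0%N; rewrite c0 mul1r.
  have h : (c j.+2 ^+ 2) ^+ j.+2 < (c j.+1 * c j.+3) ^+ j.+2.
    by rewrite ltrXn2r ?ltW ?exprn_gt0.
  rewrite -(@ltr_pM2l _ (c j.+2 ^+ j.+1)) ?exprn_gt0// -exprD.
  rewrite (_ : (_ + _ = 2 * j.+2)%N) ?exprM; last by lia.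
  apply: lt_trans h _; rewrite exprMn ltr_pM2r ?exprn_gt0//.
elim: m => // m IHm; rewrite ltnS leq_eqVlt => /predU1P[<-|km]; first exact: step.
have m0 : (0 < m)%N by apply: leq_trans km.
rewrite -(@ltr_pXn2r _ m)// ?nnegrE ?exprn_ge0 ?ltW//.
(* Raising both sides to the power [m] makes room for the step at [m]. *)
have swap (y : R) i j : (y ^+ i) ^+ j = (y ^+ j) ^+ i by rewrite -!exprM mulnC.
apply: (@lt_trans _ _ ((c m ^+ k) ^+ m.+1)).
  by rewrite [ltLHS]swap ltr_pXn2r ?nnegrE ?exprn_ge0 ?ltW ?IHm.
by rewrite [ltLHS]swap [ltRHS]swap ltr_pXn2r ?nnegrE ?exprn_ge0 ?ltW ?step.
Qed.

(** With [c j = (1 + t ^ j x) / (t ^ j + x)], which is strictly log-convex for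
    [x < 1], the two sides are [c k ^ m] and [c m ^ k] up to a common factor. *)
Lemma power_product_fold (k m : nat) (t x : R) : (0 < k)%N -> (k < m)%N ->
  0 < x < 1 -> 1 < t ->
  (1 + t ^+ k * x) ^+ m * (1 + t^-1 ^+ m * x) ^+ k <
  (1 + t^-1 ^+ k * x) ^+ m * (1 + t ^+ m * x) ^+ k.
Proof.
move=> k0 km /andP[x0 x1] t1; have t0 : 0 < t by lra.
have tj j : 0 < t ^+ j by rewrite exprn_gt0.
pose c j := (1 + t ^+ j * x) / (t ^+ j + x).
have dp j : 0 < t ^+ j + x by rewrite addr_gt0.
have np j : 0 < 1 + t ^+ j * x by rewrite addr_gt0// mulr_gt0.
have cE j : 1 + t ^+ j * x = c j * (t ^+ j + x) by rewrite /c divfK// gt_eqF.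
have cE' j : 1 + t^-1 ^+ j * x = (t ^+ j + x) / t ^+ j.
  by rewrite exprVn mulrDl divff ?gt_eqF// mulrC.
have h : c k ^+ m < c m ^+ k.
  apply: log_convex_powers => // [|j|j].
  - by rewrite /c expr0 mul1r divff// gt_eqF// addr_gt0.
  - by rewrite /c divr_gt0.
  rewrite /c expr_div_n mulf_div ltr_pdivrMr ?exprn_gt0//.
  rewrite mulrAC ltr_pdivlMr ?mulr_gt0//.
  have y1 : 1 <= t ^+ j by rewrite exprn_ege1// ltW.
  rewrite !exprS; set y := t ^+ j in y1 *.
  rewrite -subr_gt0 expr0 !mulr1.
  have -> : (1 + y * x) * (1 + t * (t * y) * x) * ((t * y + x) * (t * y + x)) -
      (1 + t * y * x) * (1 + t * y * x) * ((y + x) * (t * (t * y) + x)) =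
      (y * x) * (t - 1) ^+ 2 * ((t * y) ^+ 2 - 1) * (1 - x ^+ 2) by ring.
  have ty : 1 < t * y by nra.
  rewrite !mulr_gt0 ?exprn_gt0 ?subr_gt0 ?exprn_egt1// ?expr_lte1 ?exprn_ilt1 ?ltW//; lra.
clearbody c; rewrite !cE !cE' !expr_div_n !exprMn -!exprM (mulnC m k).
set P := (t ^+ k + x) ^+ m; set Q := (t ^+ m + x) ^+ k; set z := t ^+ (k * m).
rewrite [X in _ < X](_ : _ = c m ^+ k * (P * Q / z)); last by ring.
rewrite (_ : _ * P * (Q / z) = c k ^+ m * (P * Q / z)); last by ring.
by rewrite ltr_pM2r// !mulr_gt0 ?invr_gt0 ?exprn_gt0.
Qed.

End PowerInequalities.

(** * The functionals behind the intrinsic volumes *)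

Section MeanFunctional.
Variable R : realType.
Implicit Types (a b c s x y : R) (i m : nat).

(** Cosine of the angle with tangent [c * x]. *)
Definition icos c x : R := (Num.sqrt (1 + (c * x) ^+ 2))^-1.

Lemma icos_arg_gt0 c x : 0 < 1 + (c * x) ^+ 2.
Proof. by rewrite ltr_pwDl// sqr_ge0. Qed.

Lemma icos_gt0 c x : 0 < icos c x.
Proof. by rewrite invr_gt0 sqrtr_gt0 icos_arg_gt0. Qed.

Lemma sqr_icos c x : icos c x ^+ 2 * (1 + (c * x) ^+ 2) = 1.
Proof. by rewrite exprVn sqr_sqrtr ?mulVf ?gt_eqF ?icos_arg_gt0// ltW// icos_arg_gt0. Qed.

Lemma icos_le1 c x : icos c x <= 1.
Proof.
have i0 := ltW (icos_gt0 c x).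
rewrite -(@ler_pXn2r _ 2)// ?nnegrE// expr1n -[X in _ <= X](sqr_icos c x).
by rewrite ler_peMr ?sqr_ge0// lerDl sqr_ge0.
Qed.

Lemma icos0 c : icos c 0 = 1.
Proof. by rewrite /icos mulr0 expr0n addr0 sqrtr1 invr1. Qed.

Lemma icosZ s c x : icos (s * c) x = icos c (s * x).
Proof. by rewrite /icos; congr (Num.sqrt (1 + _ ^+ 2))^-1; ring. Qed.

Lemma deriv_icos c x : is_derive x 1 (icos c) (- (c ^+ 2 * x * icos c x ^+ 3)).
Proof.
have d1 : is_derive x 1 (fun y => 1 + (c * y) ^+ 2) (2 * c ^+ 2 * x).
  apply: is_derive_eq (deriv_add (deriv_cst 1 x) (deriv_exp 2 (deriv_scale c (deriv_id x)))) _ => /=.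
  by ring.
have s0 : Num.sqrt (1 + (c * x) ^+ 2) != 0 by rewrite gt_eqF// sqrtr_gt0 icos_arg_gt0.
apply: is_derive_eq (deriv_comp (deriv_comp d1 (is_derive1_sqrt (icos_arg_gt0 c x))) (deriv_inv s0)) _.
by rewrite /icos; set q := Num.sqrt _ in s0 *; field.
Qed.

Lemma icos_inv c x : 0 < c -> 0 < x -> icos c x^-1 = (x / c) * icos c^-1 x.
Proof.
move=> c0 x0; have i0 := ltW (icos_gt0 c x^-1); have j0 := ltW (icos_gt0 c^-1 x).
apply/eqP; rewrite -(@eqrXn2 _ 2)//; last by rewrite mulr_ge0// divr_ge0// ltW.
rewrite exprMn; apply/eqP.
have /(canRL (mulfK _)) -> := sqr_icos c x^-1; last by rewrite gt_eqF ?icos_arg_gt0.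
have /(canRL (mulfK _)) -> := sqr_icos c^-1 x; last by rewrite gt_eqF ?icos_arg_gt0.
have h1 := icos_arg_gt0 c x^-1; have h2 := icos_arg_gt0 c^-1 x.
have h : c ^+ 2 + x ^+ 2 != 0 by rewrite gt_eqF// addr_gt0// exprn_gt0.
by field; rewrite h !gt_eqF// addrC h.
Qed.

(** For an ellipsoid of semiaxes [a] (repeated) and [b], the expansion of the
    [n]-th power of the radius of a parallel body at the point with normal
    parameter [x] has the coefficients [a ^ i * profile i (n - i) a b x], up to
    binomial factors. *)
Definition profile i m a b x : R := icos a x ^+ m * icos b x ^+ i.

(** Continuous extension to [0] of [- (profile i m a b)^`() x / x]. *)
Definition density i m a b x : R :=
  profile i m a b x * (i%:R * b ^+ 2 * icos b x ^+ 2 + m%:R * a ^+ 2 * icos a x ^+ 2).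

(** The integral of the density over the half-line, that is, by parts, of
    [(1 - profile i m a b x) / x ^ 2]. *)
Definition mean_functional i m a b : R :=
  sup [set primitive (density i m a b) x | x in [set x | 0 <= x]].

Lemma profile_gt0 i m a b x : 0 < profile i m a b x.
Proof. by rewrite mulr_gt0// exprn_gt0// icos_gt0. Qed.

Lemma profile_le1 i m a b x : profile i m a b x <= 1.
Proof. by rewrite mulr_ile1 ?exprn_ge0 ?exprn_ile1 ?icos_le1 ?ltW ?icos_gt0. Qed.

Lemma profile0 i m a b : profile i m a b 0 = 1.
Proof. by rewrite /profile !icos0 !expr1n mulr1. Qed.

Lemma deriv_profile i m a b x :
  is_derive x 1 (profile i m a b) (- (x * density i m a b x)).
Proof.
apply: is_derive_eq (deriv_mul (deriv_exp m (deriv_icos a x)) (deriv_exp i (deriv_icos b x))) _.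
have E (y : R) j : j%:R * y ^+ j.-1 * y ^+ 3 = j%:R * y ^+ j * y ^+ 2.
  by case: j => [|j]; rewrite ?mul0r//= [y ^+ j.+1]exprSr; ring.
rewrite /density /profile.
have := E (icos a x) m; have := E (icos b x) i.
set p := icos a x; set q := icos b x => Eq Ep.
transitivity (- (a ^+ 2 * x) * (m%:R * p ^+ m.-1 * p ^+ 3) * q ^+ i +
   - (b ^+ 2 * x) * p ^+ m * (i%:R * q ^+ i.-1 * q ^+ 3)); first by ring.
by rewrite Ep Eq; ring.
Qed.

Lemma density_ge0 i m a b x : 0 <= density i m a b x.
Proof.
apply: mulr_ge0; first exact/ltW/profile_gt0.
by rewrite addr_ge0// mulr_ge0 ?sqr_ge0// mulr_ge0 ?sqr_ge0.
Qed.

Lemma sqr_icos_le c x : (c * x) ^+ 2 * icos c x ^+ 2 <= 1.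
Proof. by have := sqr_icos c x; have := sqr_ge0 (icos c x); nra. Qed.

Lemma density_le_cst i m a b x :
  density i m a b x <= i%:R * b ^+ 2 + m%:R * a ^+ 2.
Proof.
have sq c : icos c x ^+ 2 <= 1 by rewrite exprn_ile1 ?icos_le1 ?ltW ?icos_gt0.
apply: (@le_trans _ _ (1 * (i%:R * b ^+ 2 * icos b x ^+ 2 + m%:R * a ^+ 2 * icos a x ^+ 2))).
  by rewrite ler_wpM2r ?profile_le1// addr_ge0// mulr_ge0 ?sqr_ge0// mulr_ge0 ?sqr_ge0.
by rewrite mul1r lerD// ler_piMr ?sq// mulr_ge0 ?sqr_ge0.
Qed.

(** Integrability at infinity. *)
Lemma density_le_inv i m a b x : 0 < x -> density i m a b x <= (i + m)%:R / x ^+ 2.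
Proof.
move=> x0; rewrite ler_pdivlMr ?exprn_gt0//.
apply: (@le_trans _ _ (1 * (i%:R * b ^+ 2 * icos b x ^+ 2 + m%:R * a ^+ 2 * icos a x ^+ 2) * x ^+ 2)).
  by rewrite ler_wpM2r ?sqr_ge0// ler_wpM2r ?profile_le1// addr_ge0// mulr_ge0 ?sqr_ge0// mulr_ge0 ?sqr_ge0.
have := sqr_icos_le a x; have := sqr_icos_le b x; rewrite natrD !exprMn => hb ha.
have -> : 1 * (i%:R * b ^+ 2 * icos b x ^+ 2 + m%:R * a ^+ 2 * icos a x ^+ 2) * x ^+ 2 =
  i%:R * (b ^+ 2 * x ^+ 2 * icos b x ^+ 2) + m%:R * (a ^+ 2 * x ^+ 2 * icos a x ^+ 2) by ring.
by rewrite lerD// ler_piMr.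
Qed.

Lemma continuous_density i m a b : continuous (density i m a b).
Proof.
move=> x; apply: (deriv_continuous (deriv_mul (deriv_profile i m a b x)
  (deriv_add (deriv_scale (i%:R * b ^+ 2) (deriv_exp 2 (deriv_icos b x)))
     (deriv_scale (m%:R * a ^+ 2) (deriv_exp 2 (deriv_icos a x)))))).
Qed.

Section Primitive.
Variables (i m : nat) (a b : R).
Local Notation K := (primitive (density i m a b)).
Local Notation N := ((i + m)%:R : R).
Local Notation I := (mean_functional i m a b).

Lemma deriv_mean_primitive x : 0 <= x -> is_derive x 1 K (density i m a b x).
Proof. by apply: deriv_primitive; exact: continuous_density. Qed.

Lemma mean_primitive_ndecr x y : 0 <= x -> x <= y -> K x <= K y.
Proof.
move=> x0 xy; apply: (@deriv_ge0_le R K (density i m a b)) => // z.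
  by move=> /andP[xz _]; apply: deriv_mean_primitive; exact: le_trans xz.
by move=> _; exact: density_ge0.
Qed.

Lemma mean_primitive_ge0 x : 0 <= x -> 0 <= K x.
Proof. by move=> x0; rewrite -(primitive0 (density i m a b)) mean_primitive_ndecr. Qed.

Lemma mean_primitive_le_cst x : 0 <= x -> K x <= (i%:R * b ^+ 2 + m%:R * a ^+ 2) * x.
Proof.
move=> x0; set C := i%:R * _ + _.
have h := @deriv_ge0_le R (fun x => C * x - K x) (fun x => C * 1 - density i m a b x) 0 x x0.
rewrite -subr_ge0; apply: le_trans (h _ _) => [|z /andP[z0 _]|z _].
- by rewrite primitive0 mulr0 subr0.
- exact: deriv_sub (deriv_scale C (deriv_id z)) (deriv_mean_primitive z0).
- by rewrite mulr1 subr_ge0; exact: density_le_cst.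
Qed.

Lemma mean_primitive_tail x y : 0 < x -> 0 <= y -> K y <= K x + N / x.
Proof.
move=> x0 y0; have [yx|xy] := leP y x.
  by apply: le_trans (mean_primitive_ndecr y0 yx) _; rewrite lerDl divr_ge0// ltW.
apply: (@le_trans _ _ (K y + N / y)).
  by rewrite lerDl divr_ge0.
have h := @deriv_ge0_le R (fun x => - 1 * (K x + N * x^-1))
  (fun x => - 1 * (density i m a b x + N * (- x ^- 2))) x y (ltW xy).
rewrite -lerN2 -!(mulN1r (_ + _)); apply: h => z /andP[xz _]; have z0 : 0 < z by lra.
  exact: deriv_scale (deriv_add (deriv_mean_primitive (ltW z0))
    (deriv_scale N (deriv_inv (lt0r_neq0 z0)))).
by rewrite mulN1r mulrN oppr_ge0 subr_le0; exact: density_le_inv.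
Qed.

Lemma mean_functional_ge x : 0 <= x -> K x <= I.
Proof.
move=> x0; apply: ub_le_sup; last by exists x.
by exists (K 1 + N / 1) => _ [y y0 <-]; exact: mean_primitive_tail.
Qed.

Lemma mean_functional_le x : 0 < x -> I <= K x + N / x.
Proof.
move=> x0; apply: ge_sup; first by exists (K 0), 0 => /=.
by move=> _ [y y0 <-]; exact: mean_primitive_tail.
Qed.

(** The two bounds above pin the functional down as a limit with a rate. *)
Lemma mean_functional_unique (L C : R) :
  (forall x, 0 < x -> `|L - K x| <= C / x) -> L = I.
Proof.
move=> h; apply/eqP; rewrite -subr_eq0 -normr_le0; apply/ler_addgt0Pr => e e0; rewrite add0r.
have C0 : 0 <= C by have := h 1 ltr01; rewrite divr1; exact: le_trans.
have N0 : 0 <= N by [].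
pose x := (C + N + 1) / e; have x0 : 0 < x by rewrite divr_gt0//; lra.
have := h x x0; have := mean_functional_ge (ltW x0); have := mean_functional_le x0.
have E : (C + N) / x <= e.
  by rewrite ler_pdivrMr// /x mulrC divfK ?gt_eqF//; lra.
by move: E; rewrite mulrDl !ler_norml; lra.
Qed.

(** What is left of the primitive once the boundary term at [x] of the
    integration by parts is taken away. Its derivative involves the profile
    instead of the density, so profiles can be compared pointwise; the boundary
    term vanishes at both ends of the half-line. *)
Definition byparts x : R := K x - (1 - profile i m a b x) / x.

Lemma deriv_byparts x : 0 < x ->
  is_derive x 1 byparts ((1 - profile i m a b x) / x ^+ 2).
Proof.
move=> x0; have x1 : x != 0 by rewrite gt_eqF.
apply: is_derive_eq (deriv_sub (deriv_mean_primitive (ltW x0))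
  (deriv_mul (deriv_sub (deriv_cst 1 x) (deriv_profile i m a b x)) (deriv_inv x1))) _ => /=.
by field.
Qed.

(** The derivative of [x * K x - (1 - profile i m a b x)] is [K x >= 0]. *)
Lemma profile_primitive x : 0 <= x -> 1 - profile i m a b x <= x * K x.
Proof.
move=> x0.
have h := @deriv_ge0_le R (fun x => x * K x - (1 - profile i m a b x)) K 0 x x0.
rewrite -subr_ge0; apply: le_trans (h _ _) => [|z /andP[z0 _]|z /andP[z0 _]].
- by rewrite profile0 mul0r !subrr.
- apply: is_derive_eq (deriv_sub (deriv_mul (deriv_id z) (deriv_mean_primitive z0))
    (deriv_sub (deriv_cst 1 z) (deriv_profile i m a b z))) _ => /=.
  by ring.
- by apply: mean_primitive_ge0; exact: ltW.
Qed.

Lemma byparts_near0 x : 0 < x -> `|byparts x| <= (i%:R * b ^+ 2 + m%:R * a ^+ 2) * x.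
Proof.
move=> x0; have h : 0 <= (1 - profile i m a b x) / x <= K x.
  rewrite divr_ge0 ?subr_ge0 ?profile_le1 ?(ltW x0)//=.
  by rewrite ler_pdivrMr// mulrC profile_primitive// ltW.
have := mean_primitive_le_cst (ltW x0); rewrite /byparts ger0_norm ?subr_ge0; lra.
Qed.

Lemma byparts_nearoo x : 0 < x -> `|byparts x - I| <= (N + 1) / x.
Proof.
move=> x0; have := mean_functional_ge (ltW x0); have := mean_functional_le x0.
have : 0 <= (1 - profile i m a b x) / x <= 1 / x.
  rewrite divr_ge0 ?subr_ge0 ?profile_le1 ?(ltW x0)//= ler_pM2r ?invr_gt0//.
  by rewrite gerBl ltW ?profile_gt0.
by rewrite /byparts mulrDl ler_norml; lra.
Qed.

End Primitive.

End MeanFunctional.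

(** * Strict comparison of the functionals *)

Section Comparison.
Variable R : realType.
Implicit Types (a b c s t x y : R) (i m : nat).

Section TwoBodies.
Variables (i m : nat) (a1 b1 a2 b2 : R).
Let D x := profile i m a1 b1 x - profile i m a2 b2 x.
Let f x := byparts i m a2 b2 x - byparts i m a1 b1 x.
Let C := (i%:R * b2 ^+ 2 + m%:R * a2 ^+ 2) + (i%:R * b1 ^+ 2 + m%:R * a1 ^+ 2).
Let gap := mean_functional i m a2 b2 - mean_functional i m a1 b1.
Let N : R := ((i + m)%:R + 1) + ((i + m)%:R + 1).

Let deriv_f x : 0 < x -> is_derive x 1 f (D x / x ^+ 2).
Proof.
move=> x0; apply: is_derive_eq (deriv_sub (deriv_byparts i m a2 b2 x0) (deriv_byparts i m a1 b1 x0)) _.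
by rewrite /D; field; rewrite gt_eqF.
Qed.

Let f_near0 x : 0 < x -> `|f x| <= C * x.
Proof.
move=> x0; apply: le_trans (ler_normB _ _) _.
by rewrite /C mulrDl lerD// byparts_near0.
Qed.

Let f_nearoo x : 0 < x -> `|f x - gap| <= N / x.
Proof.
have swap (u v w z : R) : (u - v) - (w - z) = (u - w) - (v - z) by ring.
move=> x0; rewrite /f /gap swap; apply: le_trans (ler_normB _ _) _.
by rewrite /N mulrDl lerD// byparts_nearoo.
Qed.

(** Up to the boundary terms at [0] and at infinity, the difference of the two
    functionals is the integral of [D x / x ^ 2]. *)
Lemma mean_functional_lt :
  (forall x, 0 < x -> profile i m a2 b2 x < profile i m a1 b1 x) ->
  mean_functional i m a1 b1 < mean_functional i m a2 b2.
Proof.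
move=> hD.
have incf x y : 0 < x -> x < y -> f x < f y.
  move=> x0 xy; apply: (@deriv_gt0_lt R f (fun x => D x / x ^+ 2)) => // z.
    by move=> /andP[xz _]; apply: deriv_f; lra.
  move=> /andP[xz _]; have z0 : 0 < z by lra.
  by rewrite divr_gt0 ?exprn_gt0// /D subr_gt0 hD.
have h0 : 0 < f 1.
  apply: (@increasing_lim0_lt R f 0 C) => [x y x0 xy _|x /andP[x0 _]]; first exact: incf.
  by rewrite subr0 f_near0.
have hoo : - gap < - f 1^-1.
  apply: (@increasing_lim0_lt R (fun x => - f x^-1) (- gap) N) => [x y x0 xy _|x /andP[x0 _]].
    have y0 : 0 < y by lra.
    by rewrite ltrN2 incf ?invr_gt0// ltf_pV2 ?posrE.
  by rewrite -opprD normrN -[x in N * x]invrK f_nearoo// invr_gt0.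
by rewrite -subr_gt0; apply: lt_trans h0 _; rewrite -ltrN2 -[X in _ < - f X]invr1.
Qed.

(** Folding the half-line at [1] turns the integral of [D x / x ^ 2] into that
    of [D x * (x ^ -2 - x ^ n)] over the unit interval. *)
Lemma mean_functional_fold_lt (n : nat) : (0 < n)%N ->
  (forall x, 0 < x < 1 -> profile i m a2 b2 x < profile i m a1 b1 x) ->
  (forall x, 0 < x -> D x^-1 = - (x ^+ n * D x)) ->
  mean_functional i m a1 b1 < mean_functional i m a2 b2.
Proof.
move=> n0 hD hinv.
pose Q x := f x - f x^-1.
have dQ x : 0 < x -> is_derive x 1 Q (D x * (x ^- 2 - x ^+ n)).
  move=> x0; have x1 : x != 0 by rewrite gt_eqF.
  have xi : 0 < x^-1 by rewrite invr_gt0.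
  apply: is_derive_eq (deriv_sub (deriv_f x0) (deriv_comp (deriv_inv x1) (deriv_f xi))) _.
  by rewrite hinv//; field.
have : - gap < Q 1.
  apply: (@increasing_lim0_lt R Q (- gap) (C + N)) => [x y x0 xy y1|x /andP[x0 _]].
    apply: (@deriv_gt0_lt R Q (fun x => D x * (x ^- 2 - x ^+ n))) => // z.
      by move=> /andP[xz _]; apply: dQ; lra.
    move=> /andP[xz zy]; have z01 : 0 < z < 1 by lra.
    have /andP[z0 z1] := z01.
    rewrite mulr_gt0 /D ?subr_gt0 ?hD//.
    apply: (@lt_trans _ _ 1); first by rewrite exprn_ilt1 ?(ltW z0)// -lt0n.
    by rewrite -exprVn exprn_egt1// invf_gt1.
  have E (u v w : R) : u - v - - w = u - (v - w) by ring.
  rewrite /Q E.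
  apply: le_trans (ler_normB _ _) _; rewrite mulrDl lerD ?f_near0//.
  by rewrite -[x in N * x]invrK f_nearoo// invr_gt0.
by rewrite /Q invr1 subrr oppr_lt0 subr_gt0.
Qed.

End TwoBodies.

Lemma mean_functionalC i m a b : mean_functional i m a b = mean_functional m i b a.
Proof.
rewrite /mean_functional (_ : density i m a b = density m i b a)//.
by apply/funext => x; rewrite /density /profile [X in _ * X]addrC [X in X * _]mulrC.
Qed.

(** The substitution [x := s * x] in the integral of the density. *)
Lemma mean_functionalZ i m a b s : 0 < s ->
  mean_functional i m (s * a) (s * b) = s * mean_functional i m a b.
Proof.
move=> s0; apply/esym; apply: (@mean_functional_unique R i m (s * a) (s * b) _ (i + m)%:R) => x x0.
have -> : primitive (density i m (s * a) (s * b)) x = s * primitive (density i m a b) (s * x).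
  apply: (@deriv_eq R _ (fun x => s * primitive (density i m a b) (s * x))
    (density i m (s * a) (s * b)) 0 x); first exact: ltW.
  - by rewrite mulr0 !primitive0 mulr0.
  - by move=> y /andP[y0 _]; exact: deriv_mean_primitive.
  move=> y /andP[y0 _]; have sy : 0 <= s * y by rewrite mulr_ge0// ltW.
  apply: is_derive_eq (deriv_scale s (deriv_comp (deriv_scale s (deriv_id y))
    (deriv_mean_primitive i m a b sy))) _.
  by rewrite /density /profile !icosZ; ring.
have sx : 0 < s * x by rewrite mulr_gt0.
have := mean_functional_ge i m a b (ltW sx); have := mean_functional_le i m a b sx.
rewrite -mulrBr normrM gtr0_norm// => h1 h2.
rewrite ger0_norm ?subr_ge0//.
have -> : (i + m)%:R / x = s * ((i + m)%:R / (s * x)) :> R by field; rewrite !gt_eqF.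
by rewrite ler_pM2l//; lra.
Qed.

Lemma mean_functional_gt0 i m a b : 0 < a -> 0 < b -> (0 < i + m)%N ->
  0 < mean_functional i m a b.
Proof.
move=> a0 b0 im0; apply: lt_le_trans (mean_functional_ge i m a b ler01).
rewrite -(primitive0 (density i m a b)).
apply: (@deriv_gt0_lt R _ (density i m a b)) => // x; first by move=> /andP[x0 _]; exact: deriv_mean_primitive.
move=> _; rewrite mulr_gt0 ?profile_gt0//.
have P j c : 0 < c -> 0 <= j%:R * c ^+ 2 * icos c x ^+ 2 by move=> c0; rewrite mulr_ge0 ?sqr_ge0// mulr_ge0 ?sqr_ge0.
have S j c : (0 < j)%N -> 0 < c -> 0 < j%:R * c ^+ 2 * icos c x ^+ 2.
  by move=> j0 c0; rewrite !mulr_gt0 ?exprn_gt0 ?icos_gt0 ?ltr0n.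
case: (posnP i) im0 => [-> /= m0|i0 _]; last by rewrite ltr_pwDl ?S ?P.
by rewrite ltr_wpDl ?S ?P.
Qed.

(** The volume case: the integrand depends on the axis [b] alone. *)
Lemma mean_functional_top i a b : 0 < b ->
  mean_functional i 0 a b = b * mean_functional i 0 1 1.
Proof.
move=> b0; rewrite -(mean_functionalZ i 0 1 1 b0) mulr1.
have E : density i 0 a b = density i 0 b b.
  by apply/funext => x; rewrite /density /profile !expr0 !mul0r.
by rewrite /mean_functional E.
Qed.

(** The ellipsoids of revolution of the volume of the unit ball in dimension
    [i + m] have semiaxes [t] and [t ^ (1 - i - m)]. Multiplied by [t ^ (i - 1)]
    these become [t ^ i] and [t ^ - m], and homogeneity makes up for the factor;
    in this form inverting [t] is the same as exchanging [i] and [m]. *)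
Definition shape_functional i m t : R := mean_functional i m (t ^+ i) (t^-1 ^+ m).

Lemma shape_functionalV i m t : shape_functional m i t = shape_functional i m t^-1.
Proof. by rewrite /shape_functional mean_functionalC invrK. Qed.

Lemma mean_functional_shape i m c t : 0 < c -> 0 < t ->
  (c * t) ^+ i * mean_functional i m (c * t) (c * t * t^-1 ^+ (i + m)) =
  c ^+ i * (c * t) * shape_functional i m t.
Proof.
move=> c0 t0; have t1 : t != 0 by rewrite gt_eqF.
have ti : t ^+ i != 0 by rewrite expf_neq0.
have -> : c * t * t^-1 ^+ (i + m) = (c * t / t ^+ i) * t^-1 ^+ m by rewrite exprD exprVn; ring.
have -> : mean_functional i m (c * t) (c * t / t ^+ i * t^-1 ^+ m) =
    mean_functional i m (c * t / t ^+ i * t ^+ i) (c * t / t ^+ i * t^-1 ^+ m) by rewrite divfK.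
rewrite mean_functionalZ ?divr_gt0 ?mulr_gt0 ?exprn_gt0// -/(shape_functional i m t) exprMn.
by field.
Qed.

Lemma profile_lt i m a1 b1 a2 b2 x : (0 < i + m)%N ->
  (1 + a1 ^+ 2 * x ^+ 2) ^+ m * (1 + b1 ^+ 2 * x ^+ 2) ^+ i <
  (1 + a2 ^+ 2 * x ^+ 2) ^+ m * (1 + b2 ^+ 2 * x ^+ 2) ^+ i ->
  profile i m a2 b2 x < profile i m a1 b1 x.
Proof.
move=> im0; have P c : 0 < 1 + c ^+ 2 * x ^+ 2 by rewrite -exprMn icos_arg_gt0.
have E a b : profile i m a b x ^+ 2 = ((1 + a ^+ 2 * x ^+ 2) ^+ m * (1 + b ^+ 2 * x ^+ 2) ^+ i)^-1.
  have F c : icos c x ^+ 2 = (1 + c ^+ 2 * x ^+ 2)^-1.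
    by rewrite -exprMn /icos exprVn sqr_sqrtr// ltW// icos_arg_gt0.
  by rewrite /profile exprMn -!exprM !(mulnC _ 2) !exprM !F !exprVn invfM.
move=> h; have p1 := ltW (profile_gt0 i m a1 b1 x); have p2 := ltW (profile_gt0 i m a2 b2 x).
rewrite -(@ltr_pXn2r _ 2)// ?nnegrE// !E ltf_pV2// ?posrE ?mulr_gt0 ?exprn_gt0//.
Qed.

(** Away from the ball the profile decreases pointwise. *)
Lemma shape_functional_increasing i m s t : (0 < i)%N -> (0 < m)%N -> 1 <= s -> s < t ->
  shape_functional i m s < shape_functional i m t.
Proof.
move=> i0 m0 s1 st; apply: mean_functional_lt => x x0; apply: profile_lt; first by rewrite addn_gt0 i0.
have sq (u : R) j : (u ^+ j) ^+ 2 = (u ^+ 2) ^+ j by rewrite -!exprM mulnC.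
rewrite !sq !exprVn -!exprVn.
have V (u : R) : u^-1 ^+ 2 = (u ^+ 2)^-1 by rewrite exprVn.
rewrite !V; apply: power_product_increasing => //; first by rewrite exprn_gt0.
  by rewrite exprn_ege1.
by rewrite ltr_pXn2r// nnegrE; lra.
Qed.

(** The profiles of [t] and [t^-1] are exchanged, up to the factor
    [x ^ (i + m)], by [x := x^-1]; on the unit interval they compare by
    [power_product_fold], and there the weight of the fold is positive. *)
Lemma shape_functional_ltV i m t : (0 < i)%N -> (i < m)%N -> 1 < t ->
  shape_functional i m t < shape_functional i m t^-1.
Proof.
move=> i0 im t1; have t0 : 0 < t by lra.
have sq (u : R) j : (u ^+ j) ^+ 2 = (u ^+ 2) ^+ j by rewrite -!exprM mulnC.
have V (u : R) : u^-1 ^+ 2 = (u ^+ 2)^-1 by rewrite exprVn.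
apply: (@mean_functional_fold_lt _ _ _ _ _ _ (i + m)); first by rewrite addn_gt0 i0.
  move=> x /andP[x0 x1]; apply: profile_lt; first by rewrite addn_gt0 i0.
  rewrite !sq invrK !V; apply: power_product_fold => //; first by rewrite exprn_gt0//= exprn_ilt1// ltW.
  by rewrite exprn_egt1.
move=> x x0.
have E u : 0 < u -> profile i m (u ^+ i) (u^-1 ^+ m) x^-1 = x ^+ (i + m) * profile i m (u^-1 ^+ i) (u^-1^-1 ^+ m) x.
  move=> u0; have ui : 0 < u^-1 by rewrite invr_gt0.
  rewrite /profile (icos_inv (exprn_gt0 i u0) x0) (icos_inv (exprn_gt0 m ui) x0).
  rewrite -(exprVn u) -(exprVn u^-1).
  move: (icos _ x) (icos _ x) => p q.
  have e1 : (u^-1 ^+ i) ^+ m * (u^-1^-1 ^+ m) ^+ i = 1.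
    by rewrite -!exprM (mulnC m i) -exprMn divff ?expr1n// gt_eqF.
  rewrite !exprMn exprD; move: e1; move: (_ ^+ m) (_ ^+ i) => A B e1.
  transitivity (x ^+ m * x ^+ i * (B ^+ m * A ^+ i) * (q ^+ m * p ^+ i)); first by ring.
  by rewrite e1 mulr1 [x ^+ m * _]mulrC.
by rewrite !E ?invr_gt0// !invrK; ring.
Qed.

End Comparison.

(** * The profile of a parallel body of an ellipsoid of revolution *)

Section ParallelBody.
Variable R : realType.

Lemma enorm_dot_le n (x y : 'rV[R]_n) :
  \sum_(i < n) x ord0 i * y ord0 i <= enorm x * enorm y.
Proof.
have [nx|nx] := eqVneq (enorm x) 0.
  have x0 i : x ord0 i = 0.
    have /eqP := sqr_enorm x; rewrite nx expr0n eq_sym psumr_eq0 => [/allP /(_ i)|j _]; last exact: sqr_ge0.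
    by rewrite mem_index_enum => /(_ isT); rewrite sqrf_eq0 => /eqP.
  by rewrite nx mul0r big1// => i _; rewrite x0 mul0r.
have [ny|ny] := eqVneq (enorm y) 0.
  have y0 i : y ord0 i = 0.
    have /eqP := sqr_enorm y; rewrite ny expr0n eq_sym psumr_eq0 => [/allP /(_ i)|j _]; last exact: sqr_ge0.
    by rewrite mem_index_enum => /(_ isT); rewrite sqrf_eq0 => /eqP.
  by rewrite ny mulr0 big1// => i _; rewrite y0 mulr0.
have px : 0 < enorm x by rewrite lt_def nx enorm_ge0.
have py : 0 < enorm y by rewrite lt_def ny enorm_ge0.
have : 0 <= \sum_(i < n) (enorm y * x ord0 i - enorm x * y ord0 i) ^+ 2.
  by rewrite sumr_ge0// => i _; exact: sqr_ge0.
have -> : \sum_(i < n) (enorm y * x ord0 i - enorm x * y ord0 i) ^+ 2 =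
   enorm y ^+ 2 * (\sum_(i < n) x ord0 i ^+ 2) + enorm x ^+ 2 * (\sum_(i < n) y ord0 i ^+ 2) -
   2 * (enorm x * enorm y) * \sum_(i < n) x ord0 i * y ord0 i.
  by rewrite !mulr_sumr -big_split -sumrB; apply: eq_bigr => i _ /=; ring.
rewrite -!sqr_enorm; set s := \sum_(i < n) _; move: px py; move: (enorm x) (enorm y) => u v u0 v0.
have -> : v ^+ 2 * u ^+ 2 + u ^+ 2 * v ^+ 2 - 2 * (u * v) * s = 2 * (u * v) * (u * v - s) by ring.
by rewrite pmulr_rge0 ?subr_ge0// !mulr_gt0.
Qed.

Lemma enormD_le n (x y : 'rV[R]_n) : enorm (x + y) <= enorm x + enorm y.
Proof.
rewrite enorm_le ?addr_ge0 ?enorm_ge0//.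
have -> : \sum_(i < n) (x + y) ord0 i ^+ 2 =
   \sum_(i < n) x ord0 i ^+ 2 + \sum_(i < n) y ord0 i ^+ 2 + 2 * \sum_(i < n) x ord0 i * y ord0 i.
  by rewrite !mulr_sumr -!big_split; apply: eq_bigr => i _ /=; rewrite mxE; ring.
by rewrite -!sqr_enorm; have := enorm_dot_le x y; nra.
Qed.

Variable N : nat.

Definition axial (w : 'rV[R]_N.+1) : R := w ord0 ord0.
Definition radial (w : 'rV[R]_N.+1) : 'rV[R]_N := \row_i w ord0 (lift ord0 i).
Definition cons_row (h : R) (t : 'rV[R]_N) : 'rV[R]_N.+1 :=
  \row_i (if unlift ord0 i is Some j then t ord0 j else h).

Lemma axial_cons h t : axial (cons_row h t) = h.
Proof. by rewrite /axial mxE unlift_none. Qed.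

Lemma radial_cons h t : radial (cons_row h t) = t.
Proof. by apply/rowP => i; rewrite !mxE liftK. Qed.

Lemma sqr_enorm_axial w : enorm w ^+ 2 = axial w ^+ 2 + enorm (radial w) ^+ 2.
Proof.
rewrite !sqr_enorm big_ord_recl; congr (_ + _).
by apply: eq_bigr => i _; rewrite mxE.
Qed.

Lemma row_eq_axial w w' : axial w = axial w' -> radial w = radial w' -> w = w'.
Proof.
move=> h /rowP t; apply/rowP => i; case: (unliftP ord0 i) => [j|] -> //.
by have := t j; rewrite !mxE.
Qed.

Variables (a b e : R).
Hypotheses (a0 : 0 < a) (b0 : 0 < b) (e0 : 0 < e).

Definition axial_ellipsoid : set 'rV[R]_N.+1 :=
  [set x | (axial x / b) ^+ 2 + (enorm (radial x) / a) ^+ 2 <= 1].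

Definition parallel_body : set 'rV[R]_N.+1 :=
  [set x + e *: y | x in axial_ellipsoid & y in @unit_ball R N.+1].

(** Boundary point of the parallel body whose outer normal has axial and radial
    components proportional to [a * u] and [1]. *)
Definition height u := b ^+ 2 * u * icos b u + e * (a * u * icos a u).
Definition radius u := a * icos b u + e * icos a u.

Lemma radius_gt0 u : 0 < radius u.
Proof. by rewrite addr_gt0 ?mulr_gt0 ?icos_gt0. Qed.

Lemma cauchy2 (k q u v : R) : 0 < q -> q ^+ 2 * (1 + k ^+ 2) = 1 -> u ^+ 2 + v ^+ 2 <= 1 ->
  v + k * u <= q^-1.
Proof.
move=> q0 hq huv; rewrite -[q^-1]mul1r ler_pdivlMr//.
have := sqr_ge0 (q - v); have := sqr_ge0 (q * k - u); nra.
Qed.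

Lemma sum_sqr_le1 (q k l r : R) : q ^+ 2 * (1 + k ^+ 2) = 1 -> l ^+ 2 <= 1 -> r ^+ 2 <= 1 ->
  (l * (k * q)) ^+ 2 + (q * r) ^+ 2 <= 1.
Proof.
move=> h hl hr; rewrite -subr_ge0 -[X in X - _]h.
have -> : q ^+ 2 * (1 + k ^+ 2) - ((l * (k * q)) ^+ 2 + (q * r) ^+ 2) =
  (k * q) ^+ 2 * (1 - l ^+ 2) + q ^+ 2 * (1 - r ^+ 2) by ring.
by rewrite addr_ge0// mulr_ge0 ?sqr_ge0// subr_ge0.
Qed.

(** The left-hand side without its last term is the value of the support
    function of the parallel body in a direction with axial component [a * u]
    and radial component of length 1; it is attained at the boundary point. *)
Lemma height_radius u :
  a / icos b u + e / icos a u - a * u * height u = radius u.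
Proof.
have hb := sqr_icos b u; have ha := sqr_icos a u.
have p0 := icos_gt0 a u; have q0 := icos_gt0 b u.
have ha' : (icos a u)^-1 = icos a u * (1 + (a * u) ^+ 2).
  by apply: (mulIf (lt0r_neq0 p0)); rewrite mulVf ?gt_eqF// -[LHS]ha; ring.
have hb' : (icos b u)^-1 = icos b u * (1 + (b * u) ^+ 2).
  by apply: (mulIf (lt0r_neq0 q0)); rewrite mulVf ?gt_eqF// -[LHS]hb; ring.
by rewrite ha' hb' /height /radius; ring.
Qed.

(** The supporting hyperplane at height [height u] (for [s = 1]) or at the
    opposite height (for [s = -1]) bounds the radius of every section beyond. *)
Lemma parallel_body_radial (s u : R) w : `|s| = 1 -> 0 <= u -> parallel_body w ->
  height u <= s * axial w -> enorm (radial w) <= radius u.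
Proof.
move=> s1 u0 [x xE [y yB <-]] hu; rewrite -(height_radius u).
have s2 : s ^+ 2 = 1 by rewrite -(real_normK (num_real s)) s1 expr1n.
have hr : enorm (radial (x + e *: y)) <= enorm (radial x) + e * enorm (radial y).
  rewrite (_ : radial _ = radial x + e *: radial y); last by apply/rowP => i; rewrite !mxE.
  by apply: le_trans (enormD_le _ _) _; rewrite enormZ gtr0_norm.
have hx : enorm (radial x) / a + (b * u) * (s * (axial x / b)) <= (icos b u)^-1.
  by apply: cauchy2; rewrite ?icos_gt0 ?sqr_icos// exprMn s2 mul1r.
have hy : enorm (radial y) + (a * u) * (s * axial y) <= (icos a u)^-1.
  apply: cauchy2; rewrite ?icos_gt0 ?sqr_icos// exprMn s2 mul1r -sqr_enorm_axial.
  by rewrite exprn_ile1// enorm_ge0.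
have hx' : enorm (radial x) + a * u * (s * axial x) <= a / icos b u.
  rewrite -(ler_pM2l a0) in hx; apply: le_trans hx.
  by rewrite le_eqVlt; apply/orP; left; apply/eqP; field; rewrite !gt_eqF.
have hw : s * axial (x + e *: y) = s * axial x + e * (s * axial y) by rewrite /axial !mxE; ring.
move: hu; rewrite hw; move: (s * axial x) (s * axial y) hx' hy => X Y hx' hy hu.
have au : 0 <= a * u by rewrite mulr_ge0// ltW.
have hu' := ler_wpM2l au hu.
have hy' : e * (enorm (radial y) + (a * u) * Y) <= e / icos a u by rewrite ler_pM2l.
lra.
Qed.

(** Shrinking the axial and the radial components of the boundary point
    separately keeps the summands in the ellipsoid and in the ball. *)
Lemma parallel_bodyI u w : 0 <= u -> `|axial w| <= height u -> enorm (radial w) <= radius u ->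
  parallel_body w.
Proof.
move=> u0 hw rw; have r0 := radius_gt0 u.
pose l := axial w / height u.
have hl : axial w = l * height u.
  rewrite /l; have [z0|z0] := eqVneq (height u) 0; last by rewrite divfK.
  by move: hw; rewrite z0 normr_le0 => /eqP ->; rewrite mulr0.
have l1 : l ^+ 2 <= 1.
  rewrite -(real_normK (num_real l)) exprn_ile1// /l normrM normfV.
  have z0 : 0 <= height u by exact: le_trans hw.
  have [->|zn] := eqVneq (height u) 0; first by rewrite normr0 invr0 mulr0.
  by rewrite (ger0_norm z0) ler_pdivrMr ?mul1r// lt_def zn.
have k1 : (enorm (radial w) / radius u) ^+ 2 <= 1.
  by rewrite exprn_ile1 ?divr_ge0 ?enorm_ge0 ?(ltW r0)// ler_pdivrMr// mul1r.
have q0 := ltW (icos_gt0 b u); have p0 := ltW (icos_gt0 a u).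
exists (cons_row (l * (b ^+ 2 * u * icos b u)) ((a * icos b u / radius u) *: radial w)).
  rewrite /axial_ellipsoid /= axial_cons radial_cons enormZ ger0_norm; last first.
    by rewrite !mulr_ge0 ?invr_ge0 ?(ltW a0) ?(ltW r0).
  rewrite (_ : l * _ / b = l * (b * u * icos b u)); last by field; rewrite gt_eqF.
  rewrite (_ : _ * _ / a = icos b u * (enorm (radial w) / radius u)); last by field; rewrite !gt_eqF.
  exact: sum_sqr_le1 (sqr_icos b u) l1 k1.
exists (cons_row (l * (a * u * icos a u)) ((icos a u / radius u) *: radial w)).
  rewrite /unit_ball /= enorm_le// -sqr_enorm sqr_enorm_axial axial_cons radial_cons enormZ ger0_norm; last first.
    by rewrite !mulr_ge0 ?invr_ge0 ?(ltW r0).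
  rewrite (_ : icos a u / _ * _ = icos a u * (enorm (radial w) / radius u)); last by ring.
  rewrite expr1n; exact: sum_sqr_le1 (sqr_icos a u) l1 k1.
apply: row_eq_axial.
  rewrite [RHS]hl /axial !mxE unlift_none /height; ring.
apply/rowP => i; rewrite !mxE liftK !mxE -/(radial w).
have -> : a * icos b u = radius u - e * icos a u by rewrite /radius; ring.
by field; rewrite gt_eqF.
Qed.

Lemma parallel_body_axial w : parallel_body w -> `|axial w| <= b + e.
Proof.
move=> [x xE [y yB <-]].
have -> : axial (x + e *: y) = axial x + e * axial y by rewrite /axial !mxE.
apply: le_trans (ler_normD _ _) _; rewrite lerD//.
  have : (axial x / b) ^+ 2 <= 1 by apply: le_trans xE; rewrite lerDl sqr_ge0.
  rewrite -(real_normK (num_real _)) expr_le1// normrM normfV (gtr0_norm b0).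
  by rewrite ler_pdivrMr// mul1r.
rewrite normrM (gtr0_norm e0) ler_piMr ?(ltW e0)//.
rewrite -(@expr_le1 _ 2)// real_normK ?num_real//.
have /= : enorm y <= 1 := yB.
rewrite enorm_le// -sqr_enorm sqr_enorm_axial expr1n; apply: le_trans.
by rewrite lerDl sqr_ge0.
Qed.

End ParallelBody.

(** * Measurability of the parallel body *)

Section ParallelBodyMeasurable.
Variables (R : realType) (N : nat) (a b e : R).
Hypotheses (a0 : 0 < a) (b0 : 0 < b) (e0 : 0 < e).
Local Notation mR := (measurableTypeR R).
Local Notation T := (N.+1.-tuple mR).
Local Notation z := (height a b e).
Local Notation r := (radius a b e).
Local Notation S := (@parallel_body R N a b e).

Lemma deriv_height (u : R) :
  is_derive u 1 z (b ^+ 2 * icos b u ^+ 3 + e * (a * icos a u ^+ 3)).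
Proof.
have K c : is_derive u 1 (fun y => y * icos c y) (icos c u ^+ 3).
  apply: is_derive_eq (deriv_mul (deriv_id u) (deriv_icos c u)) _.
  have h := sqr_icos c u.
  rewrite -[X in X * _ + _ = _]h; set p := icos c u in h *.
  by rewrite exprMn; ring.
apply: is_derive_ext (deriv_add (deriv_scale (b ^+ 2) (K b)) (deriv_scale e (deriv_scale a (K a)))) => y.
by rewrite /height; ring.
Qed.

Lemma height_ndecr u v : u <= v -> z u <= z v.
Proof.
move=> uv; apply: (deriv_ge0_le uv (fun x _ => deriv_height x)) => x _.
by rewrite addr_ge0// ?mulr_ge0 ?exprn_ge0 ?(ltW a0) ?(ltW e0) ?(ltW b0) ?(ltW (icos_gt0 _ _)).
Qed.

Lemma height0 : z 0 = 0. Proof. by rewrite /height; ring. Qed.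

Lemma height_lipschitz u v : u <= v -> z v - z u <= (b ^+ 2 + e * a) * (v - u).
Proof.
move=> uv; set L := b ^+ 2 + e * a.
have h := @deriv_ge0_le R (fun x => L * x - z x) _ u v uv
  (fun x _ => deriv_sub (deriv_scale L (deriv_id x)) (deriv_height x)).
suff : L * u - z u <= L * v - z v by rewrite mulrBr; lra.
apply: h => x _; rewrite mulr1 subr_ge0 /L.
have P c : icos c x ^+ 3 <= 1 by rewrite exprn_ile1 ?icos_le1 ?(ltW (icos_gt0 _ _)).
rewrite lerD//; first by rewrite ler_piMr ?sqr_ge0.
by rewrite ler_wpM2l ?(ltW e0)// ler_piMr// ltW.
Qed.

Lemma radius_nincr u v : 0 <= u -> u <= v -> r v <= r u.
Proof.
move=> u0 uv.
have K c : icos c v <= icos c u.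
  rewrite lef_pV2 ?posrE ?sqrtr_gt0 ?icos_arg_gt0// ler_wsqrtr// lerD2l !exprMn.
  by rewrite ler_wpM2l ?sqr_ge0// ler_sqr ?nnegrE//; lra.
by rewrite lerD// ler_wpM2l ?(ltW a0) ?(ltW e0).
Qed.

Lemma icos_le_inv (c u : R) : 0 < c -> 0 < u -> icos c u <= (c * u)^-1.
Proof.
move=> c0 u0; have cu : 0 < c * u by rewrite mulr_gt0.
rewrite lef_pV2 ?posrE ?sqrtr_gt0 ?icos_arg_gt0// -[X in X <= _](gtr0_norm cu) -sqrtr_sqr.
by rewrite ler_wsqrtr// lerDr.
Qed.

Lemma radius_le_inv u : 0 < u -> r u <= (a / b + e / a) / u.
Proof.
move=> u0; have ha := icos_le_inv a0 u0; have hb := icos_le_inv b0 u0.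
rewrite (_ : _ / u = a * (b * u)^-1 + e * (a * u)^-1); last by field; rewrite !gt_eqF.
by rewrite lerD// ler_wpM2l ?(ltW a0) ?(ltW e0).
Qed.

Lemma sin_bounds (c u : R) : 0 < c -> 0 <= u -> 1 - icos c u <= c * u * icos c u < 1.
Proof.
move=> c0 u0; have := sqr_icos c u; have q0 := icos_gt0 c u; have q1 := icos_le1 c u.
have s0 : 0 <= c * u * icos c u by rewrite !mulr_ge0 ?(ltW c0) ?(ltW q0).
rewrite mulrDr mulr1 -exprMn [_ * (c * u)]mulrC; move: (c * u * icos c u) s0 => s s0 h.
have s1 : s < 1 by have := exprn_gt0 2 q0; nra.
by rewrite s1 andbT; nra.
Qed.

Lemma height_lt u : 0 <= u -> z u < b + e.
Proof.
move=> u0; have /andP[_ hb] := sin_bounds b0 u0; have /andP[_ ha] := sin_bounds a0 u0.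
rewrite /height (_ : b ^+ 2 * u * icos b u = b * (b * u * icos b u)); last by ring.
by rewrite ltrD// gtr_pMr.
Qed.

Lemma height_gap u : 0 < u -> b + e - z u <= (1 + e / a) / u.
Proof.
move=> u0; have /andP[hb _] := sin_bounds b0 (ltW u0); have /andP[ha _] := sin_bounds a0 (ltW u0).
have ka := icos_le_inv a0 u0; have kb := icos_le_inv b0 u0.
have hb' : b * (1 - b * u * icos b u) <= b * (b * u)^-1 by rewrite ler_wpM2l ?(ltW b0)//; lra.
have ha' : e * (1 - a * u * icos a u) <= e * (a * u)^-1 by rewrite ler_wpM2l ?(ltW e0)//; lra.
rewrite (_ : _ / u = b * (b * u)^-1 + e * (a * u)^-1); last by field; rewrite !gt_eqF.
by rewrite /height; lra.
Qed.

Lemma height_onto h : 0 <= h < b + e -> exists2 u, 0 <= u & z u = h.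
Proof.
move=> /andP[h0 hZ].
(* Here the bound of [height_gap] equals [b + e - h]. *)
pose M := (1 + e / a) / (b + e - h).
have he : 0 < 1 + e / a by rewrite addr_gt0 ?divr_gt0.
have M0 : 0 < M by rewrite divr_gt0 ?subr_gt0.
have hM : h <= z M.
  have := height_gap M0; rewrite {2}/M invf_div mulrCA divff ?mulr1; first by lra.
  by rewrite gt_eqF.
have [||u] := @IVT R z 0 M h (ltW M0).
- by apply: continuous_subspaceT => x; exact: deriv_continuous (deriv_height x).
- by rewrite height0 ge_min h0 le_max hM orbT.
by rewrite in_itv /= => /andP[u0 _] <-; exists u.
Qed.

Lemma radius_lipschitz u v : 0 <= u -> u <= v -> r u - r v <= (a * b + e * a) * (v - u).
Proof.
move=> u0 uv; set L := a * b + e * a.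
have h := @deriv_ge0_le R (fun x => L * x + r x) _ u v uv
  (fun x _ => deriv_add (deriv_scale L (deriv_id x))
     (deriv_add (deriv_scale a (deriv_icos b x)) (deriv_scale e (deriv_icos a x)))).
suff : L * u + r u <= L * v + r v by rewrite mulrBr; lra.
apply: h => x /andP[ux _]; have x0 : 0 <= x by lra.
have P c : 0 < c -> c ^+ 2 * x * icos c x ^+ 3 <= c.
  move=> c0; have /andP[_ h1] := sin_bounds c0 x0.
  have q0 := icos_gt0 c x; have q1 := icos_le1 c x.
  have -> : c ^+ 2 * x * icos c x ^+ 3 = c * ((c * x * icos c x) * icos c x ^+ 2) by ring.
  by rewrite ler_piMr ?(ltW c0)// mulr_ile1 ?sqr_ge0 ?exprn_ile1 ?(ltW q0) ?(ltW h1)// !mulr_ge0// ltW.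
have := ler_wpM2l (ltW a0) (P b b0); have := ler_wpM2l (ltW e0) (P a a0).
by rewrite /L mulr1; lra.
Qed.

Lemma radius_left_limit (u d : R) : 0 < u -> (forall q : rat, 0 <= (ratr q : R) <= u -> d <= r (ratr q)) ->
  d <= r u.
Proof.
move=> u0 h; rewrite leNgt; apply/negP => du.
set L := a * b + e * a; have L0 : 0 < L by rewrite addr_gt0 ?mulr_gt0.
have [|q] := @rat_in_itvoo R (Num.max 0 (u - (d - r u) / L)) u.
  by rewrite gt_max u0 gtrBl divr_gt0// subr_gt0.
rewrite in_itv /= gt_max => /andP[/andP[q0 qu] qu'].
have /h dq : 0 <= (ratr q : R) <= u by rewrite !ltW.
have := radius_lipschitz (ltW q0) (ltW qu'); rewrite -/L.
have : L * (u - ratr q) < d - r u by rewrite mulrC -ltr_pdivlMr//; lra.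
by lra.
Qed.

Lemma measurable_axial : measurable_fun setT (fun t : T => `|axial (row_of t)| : mR).
Proof.
apply: (measurableT_comp (f := fun x : mR => `|x| : mR)).
  exact: measurable_realfun.normr_measurable.
exact: measurable_row_of.
Qed.

Lemma measurable_radial : measurable_fun setT (fun t : T => enorm (radial (row_of t)) : mR).
Proof.
have m : measurable_fun setT (fun t : T => tuple_of (radial (row_of t))).
  apply: measurable_coord => i; under eq_fun do rewrite mxE.
  exact: measurable_row_of.
rewrite (_ : (fun t : T => _) = (fun t : N.-tuple mR => enorm (row_of t) : mR) \o
    (fun t : T => tuple_of (radial (row_of t)))).
  exact: measurableT_comp (@measurable_enorm R N) m.
by apply/funext => t /=; rewrite tuple_ofK.
Qed.

(** Countably many conditions suffice, for measurability. The heights of the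
    two poles are not values of [height] and are treated apart. *)
Lemma parallel_bodyE w : S w <->
  (`|axial w| < b + e /\ forall q : rat, 0 <= (ratr q : R) ->
     `|axial w| < z (ratr q) \/ enorm (radial w) <= r (ratr q)) \/
  (`|axial w| = b + e /\ enorm (radial w) <= 0).
Proof.
have side u : 0 <= u -> S w -> z u <= `|axial w| -> enorm (radial w) <= r u.
  move=> u0 Sw zu; have [h0|h0] := leP 0 (axial w).
    apply: (parallel_body_radial a0 b0 e0 (s := 1) (u := u)) => //; first by rewrite normr1.
    by rewrite mul1r -(ger0_norm h0).
  apply: (parallel_body_radial a0 b0 e0 (s := -1) (u := u)) => //; first by rewrite normrN1.
  by rewrite mulN1r -(ltr0_norm h0).
split=> [Sw|[[hw rw]|[hw rw]]].
- have := parallel_body_axial b0 e0 Sw; rewrite le_eqVlt => /predU1P[hw|hw]; [right|left]; split=> //.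
    apply/ler_addgt0Pr => d d0; rewrite add0r.
    set C := a / b + e / a.
    have C0 : 0 < C by rewrite addr_gt0 ?divr_gt0.
    have u0 : 0 < C / d by rewrite divr_gt0.
    have := radius_le_inv u0; rewrite -/C (_ : C / (C / d) = d) => [hr|]; last by field; rewrite !gt_eqF.
    apply: le_trans hr; apply: side Sw _; first exact: ltW.
    by rewrite hw ltW// height_lt// ltW.
  move=> q q0; have [|hq] := ltP `|axial w| (z (ratr q)); [by left|right].
  exact: side.
- have [|u u0 zu] := @height_onto `|axial w|; first by rewrite normr_ge0.
  apply: (@parallel_bodyI _ _ _ _ _ a0 b0 e0 u) => //; first by rewrite zu.
  have [uE|un] := eqVneq u 0.
    have := rw 0; rewrite !rmorph0 lexx => /(_ isT) [|]; last by rewrite uE.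
    by rewrite -zu uE ltxx.
  apply: radius_left_limit => [|q /andP[q0 qu]]; first by rewrite lt_def un.
  have [hq|//] := rw q q0.
  by have := height_ndecr qu; rewrite zu => /(lt_le_trans hq); rewrite ltxx.
have Z0 : b + e != 0 by rewrite gt_eqF// addr_gt0.
have r0 : enorm (radial w) = 0 by apply/eqP; rewrite eq_le rw enorm_ge0.
have r00 i : radial w ord0 i = 0.
  have /eqP := sqr_enorm (radial w); rewrite r0 expr0n eq_sym psumr_eq0 => [/allP /(_ i)|j _]; last exact: sqr_ge0.
  by rewrite mem_index_enum => /(_ isT); rewrite sqrf_eq0 => /eqP.
have n1 : (axial w / (b + e)) ^+ 2 = 1.
  by rewrite -(real_normK (num_real _)) normrM hw normfV ger0_norm ?divff ?expr1n// ltW// addr_gt0.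
have en0 : enorm (0 : 'rV[R]_N) = 0.
  by apply/eqP; rewrite -(@eqrXn2 _ 2)// ?enorm_ge0// sqr_enorm expr0n big1// => i _; rewrite mxE expr0n.
exists (cons_row (axial w / (b + e) * b) 0).
  rewrite /axial_ellipsoid /= axial_cons radial_cons en0 mul0r expr0n addr0.
  by rewrite mulfK ?n1// gt_eqF.
exists (cons_row (axial w / (b + e)) 0).
  rewrite /unit_ball /= enorm_le// -sqr_enorm sqr_enorm_axial axial_cons radial_cons en0.
  by rewrite n1 expr0n addr0 expr1n.
apply: row_eq_axial.
  by rewrite [LHS]mxE [X in _ + X]mxE -!/(axial _) !axial_cons; field.
by apply/rowP => i; rewrite r00 !mxE liftK !mxE mulr0 addr0.
Qed.

Lemma measurable_parallel_body : measurable [set t : T | S (row_of t)].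
Proof.
have mlt c : measurable [set t : T | `|axial (row_of t)| < c].
  rewrite (_ : [set t : T | _] = (fun t : T => `|axial (row_of t)| : mR) @^-1` [set` `]-oo, c[]).
    by apply: (measurable_setP measurable_axial); exact: measurable_itv.
  by apply/seteqP; split => t /=; rewrite in_itv.
have mle c : measurable [set t : T | enorm (radial (row_of t)) <= c].
  rewrite (_ : [set t : T | _] = (fun t : T => enorm (radial (row_of t)) : mR) @^-1` [set` `]-oo, c]]).
    by apply: (measurable_setP measurable_radial); exact: measurable_itv.
  by apply/seteqP; split => t /=; rewrite in_itv.
have meq : measurable [set t : T | `|axial (row_of t)| = b + e].
  rewrite (_ : [set t : T | _] = (fun t : T => `|axial (row_of t)| : mR) @^-1` [set b + e]).
    by apply: (measurable_setP measurable_axial).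
  by apply/seteqP; split => t /=.
pose F (q : rat) := if (0 <= ratr q :> R) then
  [set t : T | `|axial (row_of t)| < z (ratr q)] `|` [set t : T | enorm (radial (row_of t)) <= r (ratr q)]
  else setT.
have mF q : measurable (F q) by rewrite /F; case: ifP => // _; exact: measurableU.
rewrite (_ : [set t : T | _] = ([set t : T | `|axial (row_of t)| < b + e] `&` ~` (\bigcup_q ~` F q)) `|`
   ([set t : T | `|axial (row_of t)| = b + e] `&` [set t : T | enorm (radial (row_of t)) <= 0])).
  apply: measurableU; apply: measurableI => //; apply: measurableC.
  by apply: bigcupT_measurable_rat => q; exact: measurableC.
rewrite setC_bigcup; under eq_bigcapr do rewrite setCK.
apply/seteqP; split => t /=.
  move=> /parallel_bodyE [[h1 h2]|h]; [left|by right]; split => // q _.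
  by rewrite /F; case: ifP => // q0; exact: h2.
move=> h; apply/parallel_bodyE; case: h => [[h1 h2]|h]; [left|by right]; split => // q q0.
by have := h2 q I; rewrite /F q0.
Qed.

End ParallelBodyMeasurable.

(** * Slicing the parallel body *)

Section Squeeze.
Variable R : realType.

(** Along a partition of mesh [x / n] the increments of [E] add up to at most
    [L * x / n] times the total decrease of [rho]. *)
Lemma squeeze_eq0 (E z rho : R -> R) (L x : R) : 0 <= x -> 0 <= L -> E 0 = 0 ->
  (forall u, 0 <= u -> 0 <= rho u) ->
  (forall u v, 0 <= u -> u <= v -> rho v <= rho u) ->
  (forall u v, 0 <= u -> u <= v -> z v - z u <= L * (v - u)) ->
  (forall u v, 0 <= u -> u <= v -> `|E v - E u| <= (z v - z u) * (rho u - rho v)) ->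
  E x = 0.
Proof.
move=> x0 L0 E0 rho0 rhod zL hE.
have step n k : `|E (k%:R * (x / n.+1%:R))| <= L * (x / n.+1%:R) * (rho 0 - rho (k%:R * (x / n.+1%:R))).
  set d := x / _; have d0 : 0 <= d by rewrite divr_ge0.
  elim: k => [|k IHk]; first by rewrite mul0r E0 normr0 subrr mulr0.
  have uk : 0 <= k%:R * d by rewrite mulr_ge0.
  have uv : k%:R * d <= k.+1%:R * d by rewrite ler_wpM2r// ler_nat.
  have hz : z (k.+1%:R * d) - z (k%:R * d) <= L * d.
    by apply: le_trans (zL _ _ uk uv) _; rewrite -mulrBl -natrB// subSnn mul1r.
  have hr : 0 <= rho (k%:R * d) - rho (k.+1%:R * d) by rewrite subr_ge0 rhod.
  have h1 := hE _ _ uk uv; have h2 := ler_wpM2r hr hz.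
  have h3 := ler_normD (E (k.+1%:R * d) - E (k%:R * d)) (E (k%:R * d)); rewrite subrK in h3.
  by move: h1 h2 h3 IHk; lra.
apply/eqP; rewrite -normr_le0; apply/ler_addgt0Pr => eta eta0; rewrite add0r.
pose c := L * x * rho 0; have c0 : 0 <= c by rewrite !mulr_ge0 ?rho0.
have [n hn] : exists n : nat, c / eta < n.+1%:R.
  by exists (Num.truncn (c / eta)); rewrite truncnS_gt.
have n0 : 0 < n.+1%:R :> R by rewrite ltr0n.
have := step n n.+1; rewrite mulrCA divff ?gt_eqF// mulr1 => h.
apply: le_trans h _; apply: (@le_trans _ _ (L * (x / n.+1%:R) * rho 0)).
  by rewrite ler_wpM2l ?gerBl ?rho0// mulr_ge0// divr_ge0.
rewrite (_ : _ * _ * _ = c / n.+1%:R); last by rewrite /c; ring.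
by rewrite ler_pdivrMr// mulrC -ler_pdivrMr// ltW.
Qed.

(** A primitive of [rho * z'] with [rho] decreasing satisfies the same
    two-sided estimate as the volume of a body of revolution between two
    heights. *)
Lemma deriv_between (M z dz rho : R -> R) (u v : R) : u <= v ->
  (forall x : R, u <= x <= v -> is_derive x 1 M (rho x * dz x)) ->
  (forall x : R, is_derive x 1 z (dz x)) -> (forall x, 0 <= dz x) ->
  (forall x, u <= x <= v -> rho v <= rho x <= rho u) ->
  rho v * (z v - z u) <= M v - M u <= rho u * (z v - z u).
Proof.
move=> uv dM' dz' dz0 hr; apply/andP; split.
  have h := @deriv_ge0_le R (fun y => M y - rho v * z y)
    (fun y => rho y * dz y - rho v * dz y) u v uv.
  suff : M u - rho v * z u <= M v - rho v * z v by rewrite mulrBr; lra.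
  apply: h => y hy; first exact: deriv_sub (dM' y hy) (deriv_scale _ (dz' y)).
  have /hr /andP[h1 h2] : u <= y <= v by case/andP: hy => ? ?; rewrite !ltW.
  by rewrite subr_ge0 ler_wpM2r.
have h := @deriv_ge0_le R (fun y => rho u * z y - M y)
  (fun y => rho u * dz y - rho y * dz y) u v uv.
suff : rho u * z u - M u <= rho u * z v - M v by rewrite mulrBr; lra.
apply: h => y hy; first exact: deriv_sub (deriv_scale _ (dz' y)) (dM' y hy).
have /hr /andP[h1 h2] : u <= y <= v by case/andP: hy => ? ?; rewrite !ltW.
by rewrite subr_ge0 ler_wpM2r.
Qed.

End Squeeze.

Section Slabs.
Variables (R : realType) (N : nat) (a b e : R).
Hypotheses (a0 : 0 < a) (b0 : 0 < b) (e0 : 0 < e).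
Local Notation mR := (measurableTypeR R).
Local Notation T := (N.+1.-tuple mR).
Local Notation leb := (lebesgue_tuple R N.+1).
Local Notation z := (height a b e).
Local Notation r := (radius a b e).
Local Notation S := (@parallel_body R N a b e).
Local Notation kN := (kappa R N).

(** Heights between [c] and [d] on either side of the equator; half-open so
    that the two sides and adjacent slabs are disjoint. *)
Definition side (s : bool) (c d : R) : interval R :=
  if s then `[c, d[ else `[- d, - c[.

Definition disc_slab s c d rho : set T :=
  [set t | axial (row_of t) \in side s c d /\ enorm (radial (row_of t)) <= rho].

Definition body_slab s c d : set T :=
  [set t | axial (row_of t) \in side s c d /\ S (row_of t)].

Lemma side_abs s c d h : 0 <= c -> h \in side s c d -> c <= `|h| <= d.
Proof.
rewrite /side; case: s; rewrite in_itv /= => c0 /andP[h1 h2].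
  by rewrite ger0_norm ?(le_trans c0 h1)// h1 ltW.
have h0 : h < 0 by apply: lt_le_trans h2 _; rewrite oppr_le0.
by rewrite ltr0_norm//; lra.
Qed.

Lemma measurable_side s c d : measurable [set t : T | axial (row_of t) \in side s c d].
Proof.
apply: (measurable_setP (f := fun t : T => axial (row_of t) : mR) (A := [set` side s c d])).
  exact: measurable_row_of.
exact: measurable_itv.
Qed.

Lemma measurable_body_slab s c d : measurable (body_slab s c d).
Proof.
by apply: measurableI; [exact: measurable_side|exact: measurable_parallel_body].
Qed.

Lemma measurable_disc_slab s c d rho : measurable (disc_slab s c d rho).
Proof.
have mB : measurable [set t : T | enorm (radial (row_of t)) <= rho].
  rewrite (_ : [set t | _] = (fun t : T => enorm (radial (row_of t)) : mR) @^-1` [set` `]-oo, rho]]).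
    by apply: (measurable_setP (@measurable_radial R N)); exact: measurable_itv.
  by apply/seteqP; split => t /=; rewrite in_itv.
by apply: measurableI; [exact: measurable_side|exact: mB].
Qed.

Lemma lebesgue_disc_slab s c d rho : c <= d -> 0 < rho ->
  leb (disc_slab s c d rho) = ((d - c) * (kN * rho ^+ N))%:E.
Proof.
move=> cd rho0.
have E : @tuple_consp R N @^-1` disc_slab s c d rho =
    [set` side s c d] `*` [set t : N.-tuple mR | eball rho (row_of t)].
  have ax (x : mR) (t : N.-tuple mR) : axial (row_of (tuple_consp (x, t))) = x.
    by rewrite /axial mxE tnth0.
  have ra (x : mR) (t : N.-tuple mR) : radial (row_of (tuple_consp (x, t))) = row_of t.
    by apply/rowP => i; rewrite !mxE tnthS.
  by apply/seteqP; split => -[x t]; rewrite /disc_slab /= ax ra.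
rewrite /= /lebesgue_tuple_step /pushforward E product_measure1E; last 2 first.
- exact: measurable_itv.
- exact: measurable_eball.
rewrite lebesgue_eball// [RHS]EFinM; congr (_ * _)%E.
rewrite /side; case: s {E} => /=; rewrite lebesgue_measure_itv /= lte_fin.
  by case: ltP => // dc; congr EFin; lra.
rewrite ltrN2; case: ltP => [_|dc]; last by congr EFin; lra.
by rewrite -EFinB; congr EFin; ring.
Qed.

Lemma body_slab_lower s u v : 0 <= u -> u <= v ->
  disc_slab s (z u) (z v) (r v) `<=` body_slab s (z u) (z v).
Proof.
move=> u0 uv t [h1 h2]; split => //; have v0 : 0 <= v by lra.
have zu0 : 0 <= z u by rewrite -(height0 a b e) height_ndecr.
have /andP[_ hv] := side_abs zu0 h1.
exact: (parallel_bodyI a0 b0 e0 v0 hv h2).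
Qed.

Lemma body_slab_upper s u d : 0 <= u -> body_slab s (z u) d `<=` disc_slab s (z u) d (r u).
Proof.
move=> u0 t [h1 h2]; split => //.
have E : z u <= (if s then 1 else - 1) * axial (row_of t).
  by move: h1; rewrite /side; case: (s); rewrite in_itv /=; lra.
apply: (parallel_body_radial a0 b0 e0 _ u0 h2 E).
by case: (s); rewrite ?normrN normr1.
Qed.

Lemma body_slab_fin s u d : 0 <= u -> z u <= d -> leb (body_slab s (z u) d) \is a fin_num.
Proof.
move=> u0 ud; rewrite ge0_fin_numE ?measure_ge0//.
apply: (@le_lt_trans _ _ (leb (disc_slab s (z u) d (r u)))).
  apply: le_measure; rewrite ?inE; [exact: measurable_body_slab|exact: measurable_disc_slab|].
  exact: body_slab_upper.
by rewrite lebesgue_disc_slab ?radius_gt0// ltry.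
Qed.

Definition slab_volume s c d : R := fine (leb (body_slab s c d)).

Lemma lebesgue_body_slab s u d : 0 <= u -> z u <= d ->
  leb (body_slab s (z u) d) = (slab_volume s (z u) d)%:E.
Proof. by move=> u0 ud; rewrite fineK ?body_slab_fin. Qed.

Lemma slab_volume_upper s u d : 0 <= u -> z u <= d ->
  slab_volume s (z u) d <= (d - z u) * (kN * r u ^+ N).
Proof.
move=> u0 ud; rewrite -lee_fin -lebesgue_body_slab// -(@lebesgue_disc_slab s)// ?radius_gt0//.
apply: le_measure; rewrite ?inE; [exact: measurable_body_slab|exact: measurable_disc_slab|].
exact: body_slab_upper.
Qed.

Lemma slab_volume_lower s u v : 0 <= u -> u <= v ->
  (z v - z u) * (kN * r v ^+ N) <= slab_volume s (z u) (z v).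
Proof.
move=> u0 uv; have zuv := height_ndecr a0 b0 e0 uv.
rewrite -lee_fin -lebesgue_body_slab// -(@lebesgue_disc_slab s)// ?radius_gt0//.
apply: le_measure; rewrite ?inE; [exact: measurable_disc_slab|exact: measurable_body_slab|].
exact: body_slab_lower.
Qed.

Lemma slab_volume_ge0 s c d : 0 <= slab_volume s c d.
Proof. by rewrite fine_ge0. Qed.

Lemma slab_volumeD s u v d : 0 <= u -> u <= v -> z v <= d ->
  slab_volume s (z u) d = slab_volume s (z u) (z v) + slab_volume s (z v) d.
Proof.
move=> u0 uv vd; have zuv := height_ndecr a0 b0 e0 uv; have v0 : 0 <= v by lra.
have ud : z u <= d by lra.
suff E : leb (body_slab s (z u) d) = (leb (body_slab s (z u) (z v)) + leb (body_slab s (z v) d))%E.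
  rewrite (lebesgue_body_slab s u0 ud) (lebesgue_body_slab s u0 zuv) in E.
  by rewrite (lebesgue_body_slab s v0 vd) -EFinD in E; case: E.
rewrite -measureU; last 3 first.
- exact: measurable_body_slab.
- exact: measurable_body_slab.
- apply/seteqP; split => // t [[h1 _] [h2 _]]; move: h1 h2.
  by rewrite /side; case: (s); rewrite !in_itv /=; lra.
congr (leb _); apply/seteqP; split => t.
  move=> [h1 h2]; have [h|h] := boolP (axial (row_of t) \in side s (z u) (z v)); [left|right]; split => //.
  by move: h1 h; rewrite /side; case: (s); rewrite !in_itv /= => /andP[h1 h1']; rewrite negb_and -?leNgt -?ltNge; lra.
by move=> [] [h1 h2]; split => //; move: h1; rewrite /side; case: (s); rewrite !in_itv /=; lra.
Qed.

(** The volume between two heights lies between those of the inscribed and of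
    the circumscribed cylinder, and so do the increments of [M]; the two can
    only differ by a function whose increments are of second order. *)
Lemma slab_volume_prim (M : R -> R) (s : bool) (x : R) : 0 <= x -> M 0 = 0 ->
  (forall u : R, 0 <= u -> is_derive u 1 M
    (r u ^+ N * (b ^+ 2 * icos b u ^+ 3 + e * (a * icos a u ^+ 3)))) ->
  slab_volume s 0 (z x) = kN * M x.
Proof.
move=> x0 M0 dM'; have k0 := kappa_gt0 R N.
have zd u : 0 <= b ^+ 2 * icos b u ^+ 3 + e * (a * icos a u ^+ 3).
  by rewrite addr_ge0 ?mulr_ge0 ?exprn_ge0 ?(ltW a0) ?(ltW b0) ?(ltW e0) ?(ltW (icos_gt0 _ _)).
have rN u v : 0 <= u -> u <= v -> r v ^+ N <= r u ^+ N.
  move=> u0 uv; apply: lerXn2r; last exact: radius_nincr.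
    by rewrite nnegrE ltW// radius_gt0.
  by rewrite nnegrE ltW// radius_gt0.
have z00 : z 0 = 0 := height0 a b e.
pose E u := slab_volume s 0 (z u) - kN * M u.
suff : E x = 0 by move/eqP; rewrite subr_eq0 => /eqP.
apply: (@squeeze_eq0 R E z (fun u => kN * r u ^+ N) (b ^+ 2 + e * a)) => //.
- by rewrite addr_ge0 ?sqr_ge0// mulr_ge0 ?(ltW e0) ?(ltW a0).
- rewrite /E M0 mulr0 subr0; apply/eqP; rewrite eq_le slab_volume_ge0 andbT.
  by have := slab_volume_upper s (lexx 0) (lexx (z 0)); rewrite subrr mul0r z00.
- by move=> u u0; rewrite mulr_ge0 ?exprn_ge0 ?(ltW k0) ?(ltW (radius_gt0 b a0 e0 _)).
- by move=> u v u0 uv; rewrite ler_pM2l ?rN.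
- by move=> u v _ uv; exact: height_lipschitz.
move=> u v u0 uv; have zuv := height_ndecr a0 b0 e0 uv; have v0 : 0 <= v by lra.
have z0u : z 0 <= z u by rewrite height_ndecr.
have add : slab_volume s 0 (z v) = slab_volume s 0 (z u) + slab_volume s (z u) (z v).
  by have := slab_volumeD s (lexx 0) u0 zuv; rewrite z00.
have lo := slab_volume_lower s u0 uv; have up := slab_volume_upper s u0 zuv.
have /andP[Mlo Mup] : r v ^+ N * (z v - z u) <= M v - M u <= r u ^+ N * (z v - z u).
  apply: (@deriv_between R M z (fun y => b ^+ 2 * icos b y ^+ 3 + e * (a * icos a y ^+ 3))
    (fun y => r y ^+ N)) => // [y /andP[uy _]|y|y /andP[uy yv]].
  - by apply: dM'; exact: le_trans uy.
  - exact: deriv_height.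
  - by rewrite !rN//; exact: le_trans uy.
have := ler_wpM2l (ltW k0) Mlo; have := ler_wpM2l (ltW k0) Mup.
move: lo up; rewrite /E add; clear; move: (r u ^+ N) (r v ^+ N) (z v - z u) => A B C.
move: (slab_volume _ _ _) (slab_volume _ _ _) (M u) (M v) => V1 V2 m1 m2 lo up.
rewrite ler_norml; lra.
Qed.

(** Letting [x] tend to infinity exhausts the body up to its poles, since
    [height x] tends to [b + e]. *)
Lemma vol_parallel_body_approx (M : R -> R) : M 0 = 0 ->
  (forall u : R, 0 <= u -> is_derive u 1 M
    (r u ^+ N * (b ^+ 2 * icos b u ^+ 3 + e * (a * icos a u ^+ 3)))) ->
  vol S = (fine (vol S))%:E /\
  forall x : R, 0 < x -> `|fine (vol S) - 2 * kN * M x| <= 4 * (1 + e / a) * (kN * r 0 ^+ N) / x.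
Proof.
move=> M0 dM'; have k0 := kappa_gt0 R N; have z00 : z 0 = 0 := height0 a b e.
(* As [d] exceeds [b + e], the half-open slabs up to [d] contain the poles. *)
have key x : 0 < x -> let d := 2 * (b + e) - z x in
    vol S = (slab_volume true 0 d + slab_volume false 0 d)%:E.
  move=> x0 d; have zx := height_lt a0 b0 e0 (ltW x0).
  have z0d : z 0 <= d by rewrite z00 /d; have : 0 < b + e by [rewrite addr_gt0]; lra.
  have m0 s : (slab_volume s 0 d)%:E = leb (body_slab s 0 d).
    by rewrite -z00 lebesgue_body_slab.
  rewrite EFinD !m0 -measureU; last 3 first.
  - exact: measurable_body_slab.
  - exact: measurable_body_slab.
  - apply/seteqP; split => // t [[+ _] [+ _]].
    by rewrite /side !in_itv /= oppr0 => /andP[h1 _] /andP[_ h2]; have := le_lt_trans h1 h2; rewrite ltxx.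
  rewrite volE; congr (leb _); apply/seteqP; split => t /=; last by move=> [] [].
  move=> St; have := parallel_body_axial b0 e0 St; rewrite ler_norml => /andP[h1 h2].
  have [h0|h0] := leP 0 (axial (row_of t)); [left|right]; split => //.
    by rewrite /side in_itv /= h0 /d; apply: le_lt_trans h2 _; lra.
  by rewrite /side in_itv /= oppr0 h0 andbT /d; apply: le_trans h1; lra.
split; first by rewrite (key 1 ltr01).
move=> x x0; rewrite (key x x0) /=; set d := 2 * (b + e) - z x.
have zx := height_lt a0 b0 e0 (ltW x0); have gap := height_gap a0 b0 e0 x0.
have zxd : z x <= d by rewrite /d; lra.
have split_at s : slab_volume s 0 d = kN * M x + slab_volume s (z x) d.
  rewrite -(slab_volume_prim s (ltW x0) M0 dM').
  by have := slab_volumeD s (lexx 0) (ltW x0) zxd; rewrite z00.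
have up s : slab_volume s (z x) d <= 2 * (b + e - z x) * (kN * r 0 ^+ N).
  apply: le_trans (slab_volume_upper _ (ltW x0) zxd) _.
  rewrite (_ : d - z x = 2 * (b + e - z x)); last by rewrite /d; ring.
  rewrite ler_wpM2l//; first by lra.
  rewrite ler_pM2l//; apply: lerXn2r; last by apply: radius_nincr => //; exact: ltW.
    by rewrite nnegrE ltW// radius_gt0.
  by rewrite nnegrE ltW// radius_gt0.
have K0 : 0 <= kN * r 0 ^+ N by rewrite mulr_ge0 ?exprn_ge0 ?(ltW k0) ?(ltW (radius_gt0 b a0 e0 _)).
have gap' := ler_wpM2r K0 gap.
have := lerD (up true) (up false).
have p1 := slab_volume_ge0 true (z x) d; have p2 := slab_volume_ge0 false (z x) d.
rewrite !split_at; move: gap' p1 p2; clear.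
move: (slab_volume true (z x) d) (slab_volume false (z x) d) (kN * r 0 ^+ N) (b + e - z x) => V1 V2 K g gap' p1 p2 h.
rewrite (_ : _ + _ - _ = V1 + V2); last by ring.
rewrite ger0_norm ?addr_ge0//; apply: le_trans h _.
by move: gap'; rewrite -!mulrA; lra.
Qed.

End Slabs.

(** * Intrinsic volumes of ellipsoids of revolution *)

Section Steiner.
Variable R : realType.

(** Euler's relation for the binomial expansion of [(X + Y) ^ n]. *)
Lemma sum_bin_weighted (N : nat) (X Y beta alpha : R) :
  \sum_(i < N.+2) 'C(N.+1, i)%:R * X ^+ i * Y ^+ (N.+1 - i) * (i%:R * beta + (N.+1 - i)%:R * alpha) =
  N.+1%:R * (X + Y) ^+ N * (X * beta + Y * alpha).
Proof.
have S1 : \sum_(i < N.+2) 'C(N.+1, i)%:R * X ^+ i * Y ^+ (N.+1 - i) = (X + Y) ^+ N.+1.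
  rewrite addrC exprDn; apply: eq_bigr => i _; rewrite -mulr_natl; ring.
have S2 : \sum_(i < N.+2) 'C(N.+1, i)%:R * X ^+ i * Y ^+ (N.+1 - i) * i%:R = N.+1%:R * (X + Y) ^+ N * X.
  rewrite big_ord_recl mulr0 add0r [X + Y]addrC exprDn mulr_sumr mulr_suml.
  apply: eq_bigr => i _; rewrite /= /bump leq0n add1n subSS exprS -mulr_natl.
  have : (N.+1%:R * 'C(N, i)%:R : R) = i.+1%:R * 'C(N.+1, i.+1)%:R by rewrite -!natrM mul_bin_diag.
  move: (Y ^+ _) (X ^+ _) => y x h.
  rewrite [RHS](_ : _ = (N.+1%:R * 'C(N, i)%:R) * (y * x * X)); last by ring.
  by rewrite h; ring.
transitivity (\sum_(i < N.+2) ('C(N.+1, i)%:R * X ^+ i * Y ^+ (N.+1 - i) * i%:R) * (beta - alpha) +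
  \sum_(i < N.+2) ('C(N.+1, i)%:R * X ^+ i * Y ^+ (N.+1 - i)) * (N.+1%:R * alpha)).
  rewrite -big_split; apply: eq_bigr => i _ /=; rewrite natrB ?leq_ord//; ring.
by rewrite -!mulr_suml S1 S2 exprS; ring.
Qed.

Lemma deriv_sum n (f : 'I_n -> R -> R) (df : 'I_n -> R) (x : R) :
  (forall i, is_derive x 1 (f i) (df i)) ->
  is_derive x 1 (fun y => \sum_(i < n) f i y) (\sum_(i < n) df i).
Proof.
elim: n f df => [|n IHn] f df h.
  rewrite big_ord0; apply: is_derive_ext (deriv_cst 0 x) => y; by rewrite big_ord0.
rewrite big_ord_recl; apply: is_derive_ext (deriv_add (h ord0) (IHn _ _ (fun i => h (lift ord0 i)))) => y.
by rewrite big_ord_recl.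
Qed.

Variable N : nat.
Local Notation n := N.+1.
Local Notation mR := (measurableTypeR R).

Definition axis_functional (a b : R) (i : nat) : R :=
  a ^+ i * mean_functional i (n - i) a b / a.

Definition steiner_coef (a b : R) (i : nat) : R :=
  2 * kappa R N * 'C(n, i)%:R / n%:R / kappa R (n - i) * axis_functional a b i.

(** The derivative of the volume up to height [height u] is [radius u ^ N] times
    that of [height u]; its expansion in powers of [e] has the densities as
    coefficients. *)
Lemma steiner_axial_ellipsoid (a b : R) : 0 < a -> 0 < b ->
  steiner_formula (axial_ellipsoid (N := N) a b) (steiner_coef a b).
Proof.
move=> a0 b0 e e0.
have -> : vol [set x + e *: y | x in axial_ellipsoid (N := N) a b & y in @unit_ball R n] =
  vol (parallel_body (N := N) a b e) by [].
pose w (i : nat) : R := 'C(n, i)%:R * e ^+ (n - i) * a ^+ i / (n%:R * a).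
pose M (u : R) := \sum_(i < n.+1) w i * primitive (density i (n - i) a b) u.
have n0 : n%:R != 0 :> R by rewrite pnatr_eq0.
have an0 : a != 0 by rewrite gt_eqF.
have M0 : M 0 = 0 by rewrite /M big1// => i _; rewrite primitive0 mulr0.
have dM (u : R) : 0 <= u -> is_derive u 1 M
    (radius a b e u ^+ N * (b ^+ 2 * icos b u ^+ 3 + e * (a * icos a u ^+ 3))).
  move=> u0.
  apply: is_derive_eq (deriv_sum (fun i : 'I_n.+1 => deriv_scale (w i) (deriv_mean_primitive i (n - i) a b u0))) _.
  have h := sum_bin_weighted N (a * icos b u) (e * icos a u) (b ^+ 2 * icos b u ^+ 2) (a ^+ 2 * icos a u ^+ 2).
  transitivity ((n%:R * a)^-1 * (n%:R * (a * icos b u + e * icos a u) ^+ N *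
      (a * icos b u * (b ^+ 2 * icos b u ^+ 2) + e * icos a u * (a ^+ 2 * icos a u ^+ 2)))).
    rewrite -h mulr_sumr; apply: eq_bigr => i _.
    by rewrite /w /density /profile !exprMn; ring.
  by rewrite /radius; move: (_ ^+ N) => A; move: (icos a u) (icos b u) (n%:R) n0 => B C nn n0; field; rewrite an0 n0.
have [-> approx] := vol_parallel_body_approx a0 b0 e0 M0 dM.
congr EFin; move: (fine (vol (parallel_body (N := N) a b e))) approx => V approx.
set C1 := 4 * _ * _ in approx.
pose L := \sum_(i < n.+1) w i * mean_functional i (n - i) a b.
have w0 i : 0 <= w i.
  by rewrite /w divr_ge0 ?mulr_ge0 ?exprn_ge0 ?(ltW a0) ?(ltW e0).
have ML x : 0 < x -> `|L - M x| <= (\sum_(i < n.+1) w i) * n%:R / x.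
  move=> x0; rewrite /L /M -sumrB -mulrA mulr_suml.
  apply: le_trans (ler_norm_sum _ _ _) _; apply: ler_sum => i _.
  rewrite -mulrBr normrM (ger0_norm (w0 i)) ler_wpM2l//.
  have := mean_functional_ge i (n - i) a b (ltW x0); have := mean_functional_le i (n - i) a b x0.
  rewrite subnKC ?leq_ord// => h1 h2; rewrite ger0_norm ?subr_ge0//.
  by rewrite lerBlDl.
have VL : V = 2 * kappa R N * L.
  apply/eqP; rewrite -subr_eq0 -normr_le0; apply/ler_addgt0Pr => d d0; rewrite add0r.
  have k0 := kappa_gt0 R N.
  pose C2 := C1 + 2 * kappa R N * ((\sum_(i < n.+1) w i) * n%:R).
  have C1_0 : 0 <= C1 by have := approx 1 ltr01; rewrite divr1; exact: le_trans.
  have C2_0 : 0 <= C2.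
    by rewrite addr_ge0// mulr_ge0 ?(ltW k0)// ?mulr_ge0 ?(ltW k0) ?sumr_ge0.
  pose x := (C2 + 1) / d; have x0 : 0 < x by rewrite divr_gt0//; lra.
  have h : C2 / x <= d by rewrite ler_pdivrMr// /x mulrC divfK ?gt_eqF//; lra.
  apply: le_trans h; rewrite /C2 (mulrDl C1).
  rewrite (_ : V - _ = (V - 2 * kappa R N * M x) - 2 * kappa R N * (L - M x)); last by ring.
  apply: le_trans (ler_normB _ _) _; rewrite lerD ?approx//.
  by rewrite normrM ger0_norm ?mulr_ge0 ?(ltW k0)// -mulrA ler_wpM2l ?ML// mulr_ge0// ltW.
rewrite VL /L mulr_sumr; apply: eq_bigr => i _.
have ki : kappa R (n - i) != 0 by rewrite gt_eqF// kappa_gt0.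
by rewrite /steiner_coef /axis_functional /w; move: (kappa R (n - i)) ki (n%:R) n0 => k ki nn n0; field; rewrite an0 n0 ki.
Qed.

(** An isometry maps parallel bodies to parallel bodies. *)
Lemma steiner_isometry (f : 'rV[R]_n -> 'rV[R]_n) (a b : R) (V : nat -> R) :
  0 < a -> 0 < b -> euclidean_isometry f -> steiner_formula (axial_ellipsoid (N := N) a b) V ->
  steiner_formula (f @` axial_ellipsoid (N := N) a b) V.
Proof.
move=> a0 b0 isof sV e e0; rewrite -sV//.
have mS := measurable_parallel_body (N := N) a0 b0 e0.
rewrite -[RHS](vol_isometry isof mS).
have [Q oQ fE] := isometryE isof; have oQ' := mulmx1C oQ.
have nQ (P : 'M[R]_n) (x : 'rV[R]_n) : P *m P^T = 1%:M -> enorm (x *m P) = enorm x.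
  move=> oP; apply/eqP; rewrite -(@eqrXn2 _ 2)// ?enorm_ge0//.
  by rewrite !sqr_enorm_mx trmx_mul mulmxA -(mulmxA x) oP mulmx1.
congr vol; apply/seteqP; split => v [].
  move=> _ [x Kx <-] [y By <-]; exists (x + e *: (y *m Q^T)).
    by exists x => //; exists (y *m Q^T) => //; rewrite /unit_ball /= nQ// trmxK.
  by rewrite fE (fE x) mulmxDl -scalemxAl -mulmxA oQ' mulmx1 addrA.
move=> _ [x Kx [y By <-]] <-; exists (f x); first by exists x.
exists (y *m Q); first by rewrite /unit_ball /= nQ.
by rewrite fE (fE (_ + _)) mulmxDl -scalemxAl addrA.
Qed.

(** A polynomial vanishing at all positive reals is zero. *)
Lemma steiner_unique (K : set 'rV[R]_n) (V W : nat -> R) :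
  steiner_formula K V -> steiner_formula K W -> forall i, (i <= n)%N -> V i = W i.
Proof.
move=> sV sW i leni.
pose p := \poly_(j < n.+1) (kappa R j * (V (n - j)%N - W (n - j)%N)).
have pe e : 0 < e -> root p e.
  move=> e0; have := sV e e0; rewrite (sW e e0) => -[/esym/eqP].
  rewrite -subr_eq0 -sumrB /root horner_poly (reindex_inj rev_ord_inj) /= => /eqP h.
  apply/eqP; rewrite -[RHS]h; apply: eq_bigr => j _.
  by rewrite subSS (subKn (_ : j <= n)%N) ?leq_ord//; ring.
have p0 : p = 0.
  apply/eqP/negPn/negP => pn0.
  pose rs := [seq (k.+1%:R : R) | k <- iota 0 (size p)].
  have ars : all (root p) rs by apply/allP => _ /mapP[k _ ->]; rewrite pe.
  have urs : uniq rs by rewrite map_inj_uniq ?iota_uniq// => k l /eqP; rewrite eqr_nat => /eqP [].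
  by have := max_poly_roots pn0 ars urs; rewrite size_map size_iota ltnn.
have : p`_(n - i) = 0 by rewrite p0 coef0.
rewrite coef_poly ltnS leq_subr subKn// => /eqP.
by rewrite mulf_eq0 gt_eqF ?kappa_gt0//= subr_eq0 => /eqP.
Qed.

Lemma intrinsic_volume_steiner (K : set 'rV[R]_n) (V : nat -> R) (i : nat) :
  steiner_formula K V -> (i <= n)%N -> intrinsic_volume i K = V i.
Proof.
move=> sV; apply: (@steiner_unique K) => //.
by rewrite -[steiner_formula K _]/([set W | steiner_formula K W] _); apply: (xgetPex _ (ex_intro _ V sV)).
Qed.

Lemma enorm_col_perm (s : {perm 'I_n}) (x : 'rV[R]_n) : enorm (col_perm s x) = enorm x.
Proof.
rewrite /enorm; congr Num.sqrt; rewrite [RHS](reindex_inj (@perm_inj _ s)) /=.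
by apply: eq_bigr => i _; rewrite mxE.
Qed.

(** Exchanging the first and the last coordinate. *)
Lemma std_ellipsoid_axial (a b : R) :
  std_ellipsoid_of_revolution (n := n) a b =
  col_perm (tperm ord0 ord_max) @` axial_ellipsoid (N := N) a b.
Proof.
set s := tperm _ _; have sK (x : 'rV[R]_n) : col_perm s (col_perm s x) = x.
  by apply/rowP => i; rewrite !mxE /s tpermK.
have E (x : 'rV[R]_n) : \sum_(i < n) (col_perm s x) ord0 i ^+ 2 / (if i.+1 == n then b else a) ^+ 2 =
    (axial x / b) ^+ 2 + (enorm (radial x) / a) ^+ 2.
  rewrite (reindex_inj (@perm_inj _ s)) /= big_ord_recl mxE /s tpermL tpermR eqxx expr_div_n.
  congr (_ + _); rewrite expr_div_n sqr_enorm mulr_suml; apply: eq_bigr => i _.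
  rewrite !mxE tpermK; case: ifP => // /eqP [] h.
  have hm : tperm ord0 ord_max (lift ord0 i) = ord_max :> 'I_n by exact: val_inj.
  by have := congr1 (tperm ord0 (ord_max : 'I_n)) hm; rewrite tpermK tpermR => /esym/eqP; rewrite (negPf (neq_lift _ _)).
apply/seteqP; split => [x xE|_ [x xE <-]].
  by exists (col_perm s x) => //; rewrite /axial_ellipsoid /= -E sK.
by rewrite /std_ellipsoid_of_revolution /= E.
Qed.

Lemma ellipsoid_of_revolution_axial (E : set 'rV[R]_n) : ellipsoid_of_revolution E ->
  exists a b : R, [/\ 0 < a, 0 < b & exists2 f : 'rV[R]_n -> 'rV[R]_n, euclidean_isometry f & E = f @` axial_ellipsoid (N := N) a b].
Proof.
move=> [a [b [a0 b0 [f [isof ->]]]]]; exists a, b; split => //.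
exists (f \o col_perm (tperm ord0 ord_max)) => [x y|].
  rewrite /= isof -(enorm_col_perm (tperm ord0 ord_max) (x - y)).
  by congr enorm; apply/rowP => i; rewrite !mxE.
by rewrite std_ellipsoid_axial image_comp.
Qed.

Lemma intrinsic_volume_ellipsoid (f : 'rV[R]_n -> 'rV[R]_n) (a b : R) (i : nat) :
  0 < a -> 0 < b -> euclidean_isometry f -> (i <= n)%N ->
  intrinsic_volume i (f @` axial_ellipsoid (N := N) a b) = steiner_coef a b i.
Proof.
move=> a0 b0 isof; apply: intrinsic_volume_steiner.
exact: steiner_isometry (steiner_axial_ellipsoid a0 b0).
Qed.

Lemma congruent_isometric_images (f g : 'rV[R]_n -> 'rV[R]_n) (K : set 'rV[R]_n) :
  euclidean_isometry f -> euclidean_isometry g -> congruent (f @` K) (g @` K).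
Proof.
move=> isof isog; have [Q oQ fE] := isometryE isof; have oQ' := mulmx1C oQ.
pose fi x := (x - f 0) *m Q^T.
have fK x : fi (f x) = x by rewrite /fi fE addrC addKr -mulmxA oQ mulmx1.
have fiK x : f (fi x) = x by rewrite fE /fi -mulmxA oQ' mulmx1 addrC subrK.
exists (g \o fi); split; first by move=> x y; rewrite /= isog -isof !fiK.
rewrite image_comp (_ : (g \o fi) \o f = g)//.
by apply/funext => x /=; rewrite fK.
Qed.

End Steiner.

(** * Determination of the shape *)

Section Determination.
Variable R : realType.

Lemma shape_functional_inj_ge1 i m (s t : R) : (0 < i)%N -> (0 < m)%N -> 1 <= s -> 1 <= t ->
  shape_functional i m s = shape_functional i m t -> s = t.
Proof.
move=> i0 m0 s1 t1 E; have [st|ts|//] := ltgtP s t.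
  by have := shape_functional_increasing i0 m0 s1 st; rewrite E ltxx.
by have := shape_functional_increasing i0 m0 t1 ts; rewrite E ltxx.
Qed.

(** Inversion of the shape parameter exchanges the two indices, so the
    functional is injective for [t <= 1] as well. *)
Lemma shape_functional_inj_le1 i m (s t : R) : (0 < i)%N -> (0 < m)%N -> 0 < s <= 1 -> 0 < t <= 1 ->
  shape_functional i m s = shape_functional i m t -> s = t.
Proof.
move=> i0 m0 /andP[s0 s1] /andP[t0 t1]; rewrite !(shape_functionalV m i) => E.
by apply: invr_inj; apply: shape_functional_inj_ge1 E => //; rewrite invf_ge1.
Qed.

Lemma shape_functional_sides i m (s t : R) : (0 < i)%N -> (0 < m)%N -> 0 < s -> s < t ->
  shape_functional i m s = shape_functional i m t -> s < 1 < t.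
Proof.
move=> i0 m0 s0 st E; have t0 := lt_trans s0 st.
have [s1|s1] /= := ltP s 1; last first.
  by have := shape_functional_inj_ge1 i0 m0 s1 (le_trans s1 (ltW st)) E; move: st => /[swap] ->; rewrite ltxx.
have [//|t1] := ltP 1 t.
have := @shape_functional_inj_le1 i m s t i0 m0; rewrite s0 t0 t1 (ltW s1) => /(_ isT isT E).
by move: st => /[swap] ->; rewrite ltxx.
Qed.

(** Write [j] for the functional of indices [k] and [m]. If [t1 < 1 < t2] and
    [s = t1^-1], then [j s < j s^-1 = j t2 < j t2^-1 = j s], a contradiction. *)
Lemma shape_determined_pair k m (t1 t2 : R) : (0 < k)%N -> (k < m)%N -> 0 < t1 -> 0 < t2 ->
  shape_functional k m t1 = shape_functional k m t2 ->
  shape_functional m k t1 = shape_functional m k t2 -> t1 = t2.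
Proof.
move=> k0 km p1 p2 E E'.
wlog lt12 : t1 t2 p1 p2 E E' / t1 < t2.
  by move=> h; have [l|l|//] := ltgtP t1 t2;
    [exact: (h _ _ p1 p2 E E' l)|exact/esym/(h _ _ p2 p1 (esym E) (esym E') l)].
have m0 : (0 < m)%N by exact: leq_trans km.
have /andP[l1 l2] := shape_functional_sides k0 m0 p1 lt12 E.
have i1 : 1 < t1^-1 by rewrite invf_gt1.
have h1 := shape_functional_ltV k0 km i1; have h2 := shape_functional_ltV k0 km l2.
rewrite invrK in h1; move: E' h1 h2; rewrite !(shape_functionalV k m) E => -> h1 h2.
by have := lt_trans h1 h2; rewrite ltxx.
Qed.

(** For equal indices the functional only sees the shape up to inversion, and
    the second pair of indices separates [t] from [t^-1]. *)
Lemma shape_determined_half h k m (t1 t2 : R) : (0 < h)%N -> (0 < k)%N -> (0 < m)%N -> k != m ->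
  0 < t1 -> 0 < t2 ->
  shape_functional h h t1 = shape_functional h h t2 ->
  shape_functional k m t1 = shape_functional k m t2 -> t1 = t2.
Proof.
move=> h0 k0 m0 km p1 p2 E E'.
wlog lt12 : t1 t2 p1 p2 E E' / t1 < t2.
  by move=> H; have [l|l|//] := ltgtP t1 t2;
    [exact: (H _ _ p1 p2 E E' l)|exact/esym/(H _ _ p2 p1 (esym E) (esym E') l)].
have /andP[l1 l2] := shape_functional_sides h0 h0 p1 lt12 E.
have i1 : 1 < t1^-1 by rewrite invf_gt1.
have inv : t1^-1 = t2.
  exact: (shape_functional_inj_ge1 h0 h0 (ltW i1) (ltW l2) (etrans (esym (shape_functionalV h h t1)) E)).
have t1E : t1 = t2^-1 by rewrite -inv invrK.
move: E'; rewrite t1E; clear E.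
move: km; rewrite neq_ltn => /orP[lt|gt].
  by move=> E'; have := shape_functional_ltV k0 lt l2; rewrite E' ltxx.
rewrite !(shape_functionalV m k) invrK => E'.
by have := shape_functional_ltV m0 gt l2; rewrite E' ltxx.
Qed.

(** The semiaxes in terms of the radius [c] of the ball of equal volume and of
    the ratio [t = a / c]. *)
Lemma semiaxes_shape (n : nat) (a b : R) : (0 < n)%N -> 0 < a -> 0 < b ->
  exists c t : R, [/\ 0 < c, 0 < t, c ^+ n = a ^+ n.-1 * b, a = c * t & b = c * t * t^-1 ^+ n].
Proof.
move=> n0 a0 b0; pose v := a ^+ n.-1 * b; have v0 : 0 < v by rewrite mulr_gt0 ?exprn_gt0.
have c0 : 0 < v `^ n%:R^-1 by rewrite powR_gt0.
have cn : (v `^ n%:R^-1) ^+ n = v.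
  by rewrite -powR_mulrn ?(ltW c0)// -powRrM mulVf ?pnatr_eq0 -?lt0n// powRr1// ltW.
set c := v `^ _ in c0 cn *; exists c, (a / c); split => //; first by rewrite divr_gt0.
  by rewrite mulrC divfK// gt_eqF.
rewrite [c * _]mulrC divfK ?gt_eqF// invf_div expr_div_n cn /v.
have -> : a ^+ n = a * a ^+ n.-1 by rewrite -exprS prednK.
by move: (exprn_gt0 n.-1 a0); move: (a ^+ n.-1) => y y0; field; rewrite !gt_eqF.
Qed.

Variable N : nat.
Local Notation n := N.+1.

Lemma steiner_coef_inj (a1 b1 a2 b2 : R) i : (i <= n)%N ->
  steiner_coef N a1 b1 i = steiner_coef N a2 b2 i -> axis_functional N a1 b1 i = axis_functional N a2 b2 i.
Proof.
move=> le; apply: mulfI; rewrite lt0r_neq0//.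
by rewrite !divr_gt0 ?mulr_gt0 ?kappa_gt0 ?ltr0n ?bin_gt0.
Qed.

Lemma axis_functional_top (a b : R) : 0 < a -> 0 < b ->
  axis_functional N a b n = a ^+ N * b * mean_functional n 0 1 1.
Proof.
move=> a0 b0; rewrite /axis_functional subnn mean_functional_top// exprS.
by field; rewrite gt_eqF.
Qed.

Lemma axis_functional_shape (c t : R) i : 0 < c -> 0 < t -> (i <= n)%N ->
  axis_functional N (c * t) (c * t * t^-1 ^+ n) i = c ^+ i * shape_functional i (n - i) t.
Proof.
move=> c0 t0 le; rewrite /axis_functional -{2}(subnKC le) mean_functional_shape//.
by rewrite mulrAC mulfK// gt_eqF// mulr_gt0.
Qed.

(** Equal volumes reduce every comparison of intrinsic volumes to one of shapes. *)
Lemma ellipsoids_same_volume (E1 E2 : set 'rV[R]_n) :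
  ellipsoid_of_revolution E1 -> ellipsoid_of_revolution E2 ->
  intrinsic_volume n E1 = intrinsic_volume n E2 ->
  exists t1 t2 : R, [/\ 0 < t1, 0 < t2,
    forall i, (i <= n)%N -> intrinsic_volume i E1 = intrinsic_volume i E2 ->
      shape_functional i (n - i) t1 = shape_functional i (n - i) t2
    & t1 = t2 -> congruent E1 E2].
Proof.
move=> /ellipsoid_of_revolution_axial[a1 [b1 [pa1 pb1 [f1 iso1 E1E]]]].
move=> /ellipsoid_of_revolution_axial[a2 [b2 [pa2 pb2 [f2 iso2 E2E]]]].
have iv i : (i <= n)%N -> intrinsic_volume i E1 = intrinsic_volume i E2 ->
    axis_functional N a1 b1 i = axis_functional N a2 b2 i.
  by move=> le; rewrite E1E E2E !intrinsic_volume_ellipsoid//; exact: steiner_coef_inj.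
move=> /(iv n (leqnn n)); rewrite !axis_functional_top//.
have I0 : mean_functional n 0 1 1 != 0 :> R by rewrite gt_eqF// mean_functional_gt0.
move=> /(mulIf I0) vE.
have [c1 [t1 [pc1 pt1 cn1 a1E b1E]]] := semiaxes_shape (ltn0Sn N) pa1 pb1.
have [c2 [t2 [pc2 pt2 cn2 a2E b2E]]] := semiaxes_shape (ltn0Sn N) pa2 pb2.
have cE : c1 = c2.
  by apply/eqP; rewrite -(@eqrXn2 _ n)// ?(ltW pc1) ?(ltW pc2)// cn1 cn2 /= vE.
exists t1, t2; split; [exact: pt1|exact: pt2|move=> i le /(iv i le)|move=> tE].
  rewrite b1E a1E b2E a2E (axis_functional_shape pc1 pt1 le) (axis_functional_shape pc2 pt2 le) cE.
  by apply: mulfI; rewrite expf_neq0// gt_eqF.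
have aE : a1 = a2 by rewrite a1E a2E cE tE.
have bE : b1 = b2 by rewrite b1E b2E cE tE.
rewrite E1E E2E aE bE; exact: congruent_isometric_images iso1 iso2.
Qed.

End Determination.

Theorem theorem3 (R : realType) (n : nat) :
  (forall (E1 E2 : set 'rV[R]_n) (k : nat),
     ellipsoid_of_revolution E1 -> ellipsoid_of_revolution E2 ->
     (1 <= k <= n - 1)%N -> (2 * k)%N <> n ->
     intrinsic_volume n E1 = intrinsic_volume n E2 ->
     intrinsic_volume k E1 = intrinsic_volume k E2 ->
     intrinsic_volume (n - k) E1 = intrinsic_volume (n - k) E2 ->
     congruent E1 E2)
  /\
  (~~ odd n ->
   forall (E1 E2 : set 'rV[R]_n) (k : nat),
     ellipsoid_of_revolution E1 -> ellipsoid_of_revolution E2 ->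
     (1 <= k <= n - 1)%N -> (2 * k)%N <> n ->
     intrinsic_volume n E1 = intrinsic_volume n E2 ->
     intrinsic_volume n./2 E1 = intrinsic_volume n./2 E2 ->
     intrinsic_volume k E1 = intrinsic_volume k E2 ->
     congruent E1 E2).
Proof.
case: n => [|N]; first by split=> [E1 E2 k _ _|_ E1 E2 k _ _]; case: k.
split=> [E1 E2 k h1 h2 kn k2 evn evk evnk|nE E1 E2 k h1 h2 kn k2 evn evh evk].
  have [t1 [t2 [p1 p2 ev cong]]] := ellipsoids_same_volume h1 h2 evn.
  apply: cong.
  have e1 := ev k ltac:(lia) evk; have e2 := ev (N.+1 - k)%N (leq_subr _ _) evnk.
  rewrite (subKn (_ : k <= N.+1)%N) in e2; last by lia.
  have : (k < N.+1 - k)%N \/ (N.+1 - k < k)%N by lia.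
  case=> lt.
    by apply: (shape_determined_pair _ lt p1 p2 e1 e2); lia.
  by apply: (shape_determined_pair _ lt p1 p2 e2 e1); lia.
have [t1 [t2 [p1 p2 ev cong]]] := ellipsoids_same_volume h1 h2 evn.
apply: cong.
have h2n := odd_double_half N.+1; rewrite (negbTE nE) add0n -addnn in h2n.
have hE : (N.+1 - N.+1./2)%N = N.+1./2 by rewrite -{1}h2n addnK.
have hle : (N.+1./2 <= N.+1)%N by rewrite -{2}h2n leq_addr.
have e1 := ev _ hle evh; rewrite hE in e1; have e2 := ev k ltac:(lia) evk.
by apply: (shape_determined_half _ _ _ _ p1 p2 e1 e2); lia.
Qed.
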